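(* Let $\frac12\le s<1$. Let $(\delta_n)_{n\in\mathbb N}$ be a sequence of positive numbers with $\delta_n\to0$; set $\Lambda_n:=1/\delta_n$, let $T_n=L_n(\Lambda_n+1)\delta_n$ with $L_n\in\mathbb N$, and let $u_n$ be a minimizer of $\mathcal F^{T_n}_s$ in $\mathscr A^{T_n,\Lambda_n,\delta_n}$. Then $$\lim_{n\to\infty}\frac1{\sigma_n}\mathcal F^{T_n}_s(u_n)=1,$$ where $\sigma_n:=\log\frac1{\delta_n}$ if $s=\frac12$, and $\sigma_n:=\dfrac{\delta_n^{1-2s}}{2s(1-s)(2s-1)(3-2s)}$ if $\frac12<s<1$.
   Context: For $\Lambda,\delta>0$ and $T=L(\Lambda+1)\delta$ with $L\in\mathbb N$, the admissible class $\mathscr A^{T,\Lambda,\delta}$ is the set of continuous, $T$-periodic, piecewise affine functions $u:\mathbb R\to\mathbb R$ with $u'\in\{1,-\Lambda\}$ a.e., such that $(u')^{-1}(\{-\Lambda\})=\bigcup_{k\in\mathbb N}I^k$ for some intervals $I^k$ with $|I^k|=\delta$ for all $k$ and $\#(I^i\cap I^j)\le1$ for all $i\ne j$. For $0<s<1$, $$\mathcal F^T_s(u):=\frac1{2T}\int_0^T dx\int_{\mathbb R}\frac{|u(x)-u(y)|^2}{|x-y|^{1+2s}}\,dy.$$ *)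

(* Defs.v *)
From HB Require Import structures.
From mathcomp Require Import all_boot all_order all_algebra.
From mathcomp Require Import all_classical all_reals all_analysis.
Set Implicit Arguments. Unset Strict Implicit. Unset Printing Implicit Defensive.
Import Order.TTheory GRing.Theory Num.Theory.
Import numFieldNormedType.Exports.
Local Open Scope classical_set_scope.
Local Open Scope ring_scope.

Section Defs.
Variable R : realType.

Definition piecewise_affine (u : R -> R) : Prop :=
  forall a b : R, a < b ->
  exists (m : nat) (t : nat -> R),
    [/\ t 0%N = a, t m = b,
        (forall i, (i < m)%N -> t i < t i.+1) &
        (forall i, (i < m)%N -> exists alpha beta : R,
            forall x, t i <= x <= t i.+1 -> u x = alpha * x + beta)].

Definition neg_slope_set (u : R -> R) (Lambda : R) : set R :=
  [set x | derivable u x 1 /\ derive1 u x = - Lambda].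

Definition admissible (T Lambda delta : R) (u : R -> R) : Prop :=
  [/\ continuous u,
      (forall x, u (x + T) = u x),
      piecewise_affine u,
      {ae (@lebesgue_measure R), forall x,
          derivable u x 1 /\ (derive1 u x = 1 \/ derive1 u x = - Lambda)} &
      exists (a : nat -> R) (b1 b2 : nat -> bool),
        let I := fun k => [set` Interval (BSide (b1 k) (a k)) (BSide (b2 k) (a k + delta))] in
        (neg_slope_set u Lambda = \bigcup_k I k) /\
            (forall i j, i <> j -> forall x y, I i x -> I j x -> I i y -> I j y -> x = y)].

Definition FT (T s : R) (u : R -> R) : \bar R :=
  ((2 * T)^-1)%:E *
  (\int[@lebesgue_measure R]_(x in `[0%R, T])
     \int[@lebesgue_measure R]_(y in [set: R])
        ((`|u x - u y| ^+ 2 / (`|x - y| `^ (1 + 2 * s)))%:E))%E.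

Definition is_minimizer (T Lambda delta s : R) (u : R -> R) : Prop :=
  admissible T Lambda delta u /\
  forall v, admissible T Lambda delta v -> (FT T s u <= FT T s v)%E.

Definition sigma_scale (s delta : R) : R :=
  if s == 2^-1 then ln (delta^-1)
  else delta `^ (1 - 2 * s) / (2 * s * (1 - s) * (2 * s - 1) * (3 - 2 * s)).

End Defs.

(* Main.v *)
Require Import Defs.
From HB Require Import structures.
From mathcomp Require Import all_boot all_order all_algebra.
From mathcomp Require Import all_classical all_reals all_analysis.
From mathcomp Require Import measurable_realfun ring lra.
Import Order.TTheory GRing.Theory Num.Theory.
Import numFieldNormedType.Exports.
Local Open Scope classical_set_scope.
Local Open Scope ring_scope.

(** Put [p x = x - u x]: it is nondecreasing, and [p y - p x] is [1 + Lambda] times the measure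
    of the part of [[x, y]] where [u] has slope [- Lambda].  By Tonelli and periodicity,
    [FT T s u = 1/T \int_(h > 0) h^-(1+2s) G h] with [G h = \int_0^T |u (x + h) - u x|^2], and
    [\int_0^T |p (x + h) - p x|^2 = G h + T h^2] because increments of [u] have mean zero.
    The [L] descending intervals of a period contribute nonnegatively to [p (x + h) - p x], so
    dropping the cross terms of the square gives
    [G h + T h^2 >= L (1 + Lambda)^2 \int |]x, x + h[ `&` ]0, delta[|^2 dx].
    For the sawtooth, whose descending intervals lie at mutual distance 1, the cross terms vanish
    when [h <= 1], so it satisfies the reverse inequality, while the range [h > 1] costs only a
    bounded amount.  The kernel integral of the common right-hand side is explicit, and both
    bounds are [(1 + delta) sigma + O(1)]. *)

Set Implicit Arguments. Unset Strict Implicit. Unset Printing Implicit Defensive.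

(** * Translations, periods, and the energy as an integral over increments *)

Section Integrals.
Context {R : realType}.
Local Notation mu := (@lebesgue_measure R).
Local Open Scope ereal_scope.

(** The shape of a minimizer is never analysed: the lower bound holds for every admissible function,
    and minimality serves only to compare with the sawtooth. Both bounds on [G h + T h^2] are
    proportional to [L], as is [T = L (1 + delta)], so the bounds on the energy do not see how [L]
    varies along the sequence. The cut at [h = 1] is the gap of the sawtooth. Below it the
    correction [T h^2] has a finite kernel integral because [s < 1]; above it the lower bound
    discards the energy. The bounded errors disappear in the limit because [sigma] diverges. The
    obstacle on the lower side is that admissibility gives the descending set only as a countable
    union of intervals on the line, unrelated to the period. That a well-chosen period contains at
    least [L] whole intervals is recovered from measure. Moreover, increments taken near the end of
    a period see intervals of the next one, so translates by [T] must be carried along. *)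

Lemma measurable_addr (c : R) : measurable_fun [set: measurableTypeR R]
  (fun x : measurableTypeR R => x + c : measurableTypeR R)%R.
Proof. exact: (@measurable_funD _ _ R setT id (cst c)). Qed.

Lemma addr_preimage_itv (c a b : R) (b1 b2 : bool) :
  (fun x : R => x + c)%R @^-1` [set` Interval (BSide b1 a) (BSide b2 b)]
  = [set` Interval (BSide b1 (a - c)%R) (BSide b2 (b - c)%R)].
Proof.
by apply/seteqP; split => x /=; rewrite !in_itv/=;
  case: b1 b2 => [] [] /=; rewrite ?lerBlDr ?ltrBlDr ?lerBrDr ?ltrBrDr.
Qed.

(** The translated measure gives every half-open interval its length, and this determines Lebesgue
    measure. *)
Lemma lebesgue_measure_addr (c : R) (A : set R) : measurable A ->
  pushforward mu (fun x : R => x + c : measurableTypeR R)%R A = mu A.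
Proof.
move=> mA.
pose m : {measure set (measurableTypeR R) -> \bar R} :=
  measure_function_pushforward__canonical__measure_function_Measure mu (measurable_addr c).
apply/esym; apply: (@lebesgue_measure_unique R m) => // _ [[a b]] _ <-.
rewrite /m/=.
rewrite /pushforward addr_preimage_itv !lebesgue_measure_itv/=.
by rewrite !lte_fin ltrD2r -!EFinB; congr (if _ then (_)%:E else _); ring.
Qed.

Lemma ge0_integral_addr (c : R) (D : set R) (f : R -> \bar R) :
  measurable D -> measurable_fun D f -> (forall x, D x -> 0 <= f x) ->
  \int[mu]_(x in D) f x = \int[mu]_(x in (fun x => x + c)%R @^-1` D) f (x + c)%R.
Proof.
move=> mD mf f0.
pose m : {measure set (measurableTypeR R) -> \bar R} :=
  measure_function_pushforward__canonical__measure_function_Measure mu (measurable_addr c).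
transitivity (\int[m]_(x in D) f x).
  apply: (@eq_measure_integral _ (measurableTypeR R)) => A mA AS.
  exact/esym/lebesgue_measure_addr.
apply: (@ge0_integral_pushforward _ _ (measurableTypeR R) (measurableTypeR R) R _
  (measurable_addr c) mu D f) => //.
by move=> x; rewrite inE; exact: f0.
Qed.

Lemma ge0_integral_itv_addr (c a b : R) (b1 b2 : bool) (f : R -> \bar R) :
  measurable_fun [set: R] f -> (forall x, 0 <= f x) ->
  \int[mu]_(x in [set` Interval (BSide b1 a) (BSide b2 b)]) f (x + c)%R =
  \int[mu]_(x in [set` Interval (BSide b1 (a + c)%R) (BSide b2 (b + c)%R)]) f x.
Proof.
move=> mf f0; rewrite [RHS](ge0_integral_addr c)//; last exact: measurable_funTS.
by rewrite addr_preimage_itv !addrK.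
Qed.

Lemma itv_co_split (a b c : R) : (a <= b)%R -> (b <= c)%R ->
  `[a, c[%classic = `[a, b[ `|` `[b, c[.
Proof.
move=> ab bc; apply/seteqP; split => x /=; rewrite !in_itv/=.
  by move=> /andP[ax xc]; case: (ltP x b) => xb; [left|right]; rewrite ?ax ?xb ?xc.
by move=> [] /andP[h1 h2]; [rewrite h1 (lt_le_trans h2)|rewrite (le_trans ab h1) h2].
Qed.

Lemma ge0_integral_co_split (a b c : R) (f : R -> \bar R) :
  (a <= b)%R -> (b <= c)%R -> measurable_fun [set: R] f -> (forall x, 0 <= f x) ->
  \int[mu]_(x in `[a, c[) f x = \int[mu]_(x in `[a, b[) f x + \int[mu]_(x in `[b, c[) f x.
Proof.
move=> ab bc mf f0; rewrite (itv_co_split ab bc) ge0_integral_setU//.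
- exact: measurable_funTS.
- by apply/disj_setPS => x /=; rewrite !in_itv/= => -[/andP[_ xb] /andP[bx _]]; move: (lt_le_trans xb bx); rewrite ltxx.
Qed.

Lemma periodic_int (T : Type) (P : R) (f : R -> T) : (forall x, f (x + P)%R = f x) ->
  forall (k : int) x, f (x + k%:~R * P)%R = f x.
Proof.
move=> fP [] n x.
  elim: n x => [|n IH] x; first by rewrite mul0r addr0.
  by rewrite -[RHS]IH -[RHS]fP; congr f; rewrite -!pmulrn -natr1; ring.
rewrite NegzE; elim: n x => [|n IH] x.
  by rewrite -[LHS]fP mulN1r subrK.
by rewrite -[RHS]IH -[LHS]fP; congr f; rewrite !mulrNz -!pmulrn -[n.+2%:R]natr1; ring.
Qed.

(** A shift by a whole number of periods brings [c] to its remainder [r] modulo [P]; the part of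
    [[r, r + P[] beyond [P] is then moved back by one period to fill [[0, r[]. *)
Lemma ge0_integral_periodic (P c : R) (f : R -> \bar R) : (0 < P)%R ->
  measurable_fun [set: R] f -> (forall x, 0 <= f x) -> (forall x, f (x + P)%R = f x) ->
  \int[mu]_(x in `[c, (c + P)%R[) f x = \int[mu]_(x in `[0%R, P[) f x.
Proof.
move=> P0 mf f0 fP.
pose k := Num.floor (c / P); pose r := (c - k%:~R * P)%R.
have kc : (k%:~R * P <= c)%R by rewrite -ler_pdivlMr//; exact: floor_le.
have ck : (c < k%:~R * P + P)%R.
  by rewrite -{2}[P]mul1r -mulrDl -ltr_pdivrMr// -[1%R]/(1%:~R) -intrD; exact: floorD1_gt.
have r0 : (0 <= r)%R by rewrite subr_ge0.
have e1 : (r + k%:~R * P = c)%R by rewrite /r subrK.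
have e2 : (r + P + k%:~R * P = c + P)%R by rewrite -e1 addrAC.
have rP : (r <= P)%R by rewrite /r; lra.
have -> : `[c, (c + P)%R[%classic = `[(r + k%:~R * P)%R, (r + P + k%:~R * P)%R[%classic :> set R.
  by rewrite e1 e2.
rewrite -ge0_integral_itv_addr//.
under eq_integral do rewrite periodic_int//.
rewrite (@ge0_integral_co_split r P)//; last by lra.
rewrite (@ge0_integral_co_split 0 r P)// addeC; congr (_ + _).
have -> : `[P, (r + P)%R[%classic = `[(0 + P)%R, (r + P)%R[%classic :> set R by rewrite add0r.
by rewrite -ge0_integral_itv_addr//; under eq_integral do rewrite fP.
Qed.

Lemma integral_periodic (P c : R) (f : R -> \bar R) : (0 < P)%R ->
  measurable_fun [set: R] f -> (forall x, f (x + P)%R = f x) ->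
  \int[mu]_(x in `[c, (c + P)%R[) f x = \int[mu]_(x in `[0%R, P[) f x.
Proof.
move=> P0 mf fP; rewrite integralE [RHS]integralE; congr (_ - _).
  by apply: ge0_integral_periodic => //; [exact: measurable_funepos|move=> x; rewrite !funeposE fP].
by apply: ge0_integral_periodic => //; [exact: measurable_funeneg|move=> x; rewrite !funenegE fP].
Qed.

Lemma ge0_integral_periods (P : R) (n : nat) (f : R -> \bar R) : (0 < P)%R ->
  measurable_fun [set: R] f -> (forall x, 0 <= f x) -> (forall x, f (x + P)%R = f x) ->
  \int[mu]_(x in `[0%R, (n%:R * P)%R[) f x = n%:R%:E * \int[mu]_(x in `[0%R, P[) f x.
Proof.
move=> P0 mf f0 fP; elim: n => [|n IH].
  by rewrite mul0r mul0e set_itvco0 integral_set0.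
rewrite -natr1 mulrDl mul1r (@ge0_integral_co_split 0 (n%:R * P))//; last 2 first.
- by rewrite mulr_ge0// ltW.
- by rewrite lerDl ltW.
rewrite IH ge0_integral_periodic// EFinD ge0_muleDl ?mul1e//.
Qed.
End Integrals.

Section Energy.
Context {R : realType}.
Local Notation mu := (@lebesgue_measure R).
Local Open Scope ereal_scope.

Lemma ge0_integral_even (f : R -> \bar R) :
  measurable_fun [set: R] f -> (forall x, 0 <= f x) -> (forall x, f (- x)%R = f x) ->
  \int[mu]_x f x = 2%:E * \int[mu]_(x in `]0%R, +oo[) f x.
Proof.
move=> mf f0 fN.
have -> : [set: R] = `]-oo, 0%R] `|` `]0%R, +oo[.
  by rewrite -(setvU `]-oo, 0%R]) setCitvl setUC.
rewrite ge0_integral_setU//; last 2 first.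
- exact: measurable_funTS.
- apply/disj_setPS => x /=; rewrite !in_itv/= andbT => -[x0 /(le_lt_trans x0)].
  by rewrite ltxx.
have <- : \int[mu]_(x in `[0%R, +oo[) f x = \int[mu]_(x in `]-oo, 0%R]) f x.
  by rewrite ge0_integration_by_substitution0//; under eq_integral do rewrite fN.
rewrite -integral_itv_obnd_cbnd; last exact: measurable_funTS.
by rewrite -mule2n -mule_natl.
Qed.

(** This is [G h] of the overview. The period is half-open so that consecutive periods tile the
    line. *)
Definition increment_energy (T : R) (u : R -> R) (h : R) : \bar R :=
  \int[mu]_(x in `[0%R, T[) (((u (x + h) - u x) ^+ 2)%:E).

Lemma measurable_increment (u : R -> R) (h : R) : measurable_fun [set: R] u ->
  measurable_fun [set: R] (fun x => (((u (x + h) - u x) ^+ 2)%:E)).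
Proof.
move=> mu_; apply/measurable_EFinP; apply: measurable_funX; apply: measurable_funB => //.
by apply: (measurableT_comp mu_); exact: measurable_addr.
Qed.

Lemma increment_energyN (T : R) (u : R -> R) (h : R) : (0 < T)%R ->
  measurable_fun [set: R] u -> (forall x, u (x + T) = u x)%R ->
  increment_energy T u (- h)%R = increment_energy T u h.
Proof.
move=> T0 mu_ uT; rewrite /increment_energy.
pose f x := (((u (x + h) - u x) ^+ 2)%:E).
transitivity (\int[mu]_(x in `[0%R, T[) f (x + - h)%R).
  by apply: eq_integral => x _; rewrite /f subrK -sqrrN opprB.
have mf : measurable_fun [set: R] f by exact: measurable_increment.
have f0 x : 0 <= f x by rewrite lee_fin sqr_ge0.
rewrite ge0_integral_itv_addr// [(0 - h)%R]addrC [(T - h)%R]addrC addr0.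
by rewrite ge0_integral_periodic// => x; rewrite /f addrAC !uT.
Qed.

(** The substitution [y = x + h] makes the kernel depend on [h] alone, and Tonelli moves the
    integral in [x] inside. The result is even in [h] by [increment_energyN], so passing to the half
    line cancels the [1/2] of [FT]. Measurability of the weighted increment energy is a by-product
    of Tonelli that the later estimates need. *)
Lemma FT_increment_energy (T s : R) (u : R -> R) : (0 < T)%R -> (0 < s)%R ->
  measurable_fun [set: R] u -> (forall x, u (x + T) = u x)%R ->
  measurable_fun [set: R] (fun h => (`|h| `^ (- (1 + 2 * s)))%:E * increment_energy T u h) /\
  FT T s u = (T^-1)%:E *
    \int[mu]_(h in `]0%R, +oo[) ((`|h| `^ (- (1 + 2 * s)))%:E * increment_energy T u h).
Proof.
move=> T0 s0 mu_ uT.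
pose D := `[0%R, T[%classic : set R.
pose w (h : R) := (`|h| `^ (- (1 + 2 * s)))%R.
have w0 h : (0 <= w h)%R by exact: powR_ge0.
have mw : measurable_fun [set: R] w.
  by apply: (measurableT_comp (measurable_powR _)); exact: normr_measurable.
pose K (z : R * R) := (w z.2 * (u (z.1 + z.2) - u z.1) ^+ 2)%:E.
(* The indicator of the period is absorbed in the integrand so that Tonelli applies on the whole
   plane. *)
pose KD (z : R * R) := ((\1_D z.1)%:E * K z).
have mD : measurable D by exact: measurable_itv.
have mK : measurable_fun [set: R * R] K.
  apply/measurable_EFinP; apply: measurable_funM.
    by apply: (measurableT_comp mw); exact: measurable_snd.
  apply: measurable_funX; apply: measurable_funB.
    apply: (measurableT_comp mu_); apply: measurable_funD.
      exact: measurable_fst.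
    exact: measurable_snd.
  by apply: (measurableT_comp mu_); exact: measurable_fst.
have K0 z : 0 <= K z by rewrite lee_fin mulr_ge0// sqr_ge0.
have mKD : measurable_fun [set: R * R] KD.
  apply: emeasurable_funM => //; apply/measurable_EFinP.
  apply: (@measurableT_comp _ _ _ _ _ _ (\1_D : R -> R)); last exact: measurable_fst.
  exact: measurable_indic.
have KD0 z : 0 <= KD z by rewrite mule_ge0// lee_fin.
have swap h : \int[mu]_x KD (x, h) = (w h)%:E * increment_energy T u h.
  rewrite /increment_energy -/D -ge0_integralZl_EFin//; last 2 first.
  - by move=> x _; rewrite lee_fin sqr_ge0.
  - by apply: measurable_funTS; exact: measurable_increment.
  rewrite [RHS]integral_mkcond; apply: eq_integral => x _.
  rewrite /KD /K /= patchE indicE; case: (x \in D); last by rewrite mul0e.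
  by rewrite mul1e EFinM.
have mE : measurable_fun [set: R] (fun h => (w h)%:E * increment_energy T u h).
  rewrite [X in measurable_fun _ X](_ : _ = fun h => \int[mu]_x KD (x, h)); last first.
    by apply/funext => h; rewrite swap.
  exact: (@measurable_fun_fubini_tonelli_G _ _ _ _ _ mu KD mKD KD0).
split => //.
rewrite /FT.
have inner x : \int[mu]_y ((`|u x - u y| ^+ 2 / `|x - y| `^ (1 + 2 * s))%:E) =
    \int[mu]_h K (x, h).
  rewrite (ge0_integral_addr x)//; last first.
  - apply/measurable_EFinP; apply: measurable_funM.
      by apply: measurable_funX; apply: measurableT_comp; last exact: measurable_funB.
    under eq_fun do rewrite -powRN.
    apply: (measurableT_comp (measurable_powR _)) => //.
    by apply: measurableT_comp; last exact: measurable_funB.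
  rewrite preimage_setT; apply: eq_integral => h _.
  rewrite /K /w/= powRN real_normK ?num_real// -sqrrN opprB mulrC [(h + x)%R]addrC.
  by rewrite opprD addNKr normrN.
under eq_integral do rewrite inner.
rewrite -integral_itv_bndo_bndc; last first.
  by apply: measurable_funTS; exact: (@measurable_fun_fubini_tonelli_F _ _ _ _ _ mu K mK K0).
rewrite integral_mkcond.
have restr x : ((fun x => \int[mu]_h K (x, h)) \_ D) x = \int[mu]_h KD (x, h).
  rewrite patchE /KD/= indicE; case: ifPn => xD.
    by apply: eq_integral => h _; rewrite mul1e.
  by rewrite integral0_eq// => h _; rewrite mul0e.
under eq_integral do rewrite restr.
have -> : \int[mu]_x \int[mu]_h KD (x, h) = \int[mu]_h \int[mu]_x KD (x, h).
  exact: (@fubini_tonelli _ _ _ _ _ mu mu KD mKD KD0).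
under eq_integral do rewrite swap.
rewrite ge0_integral_even//.
- rewrite muleA -EFinM invfM mulrAC mulVf// mul1r//.
- by move=> h; rewrite mule_ge0 ?lee_fin// integral_ge0// => x _; rewrite lee_fin sqr_ge0.
- by move=> h; rewrite /w normrN increment_energyN.
Qed.
End Energy.

(** * Overlaps of intervals and primitives *)

Section Primitives.
Context {R : realType}.
Local Notation mu := (@lebesgue_measure R).

Lemma FTC_cc (f F : R -> R) (a b : R) : a <= b ->
  (forall x, a <= x <= b -> exists2 df, is_derive x 1 F df & df = f x) ->
  (forall x, a <= x <= b -> {for x, continuous f}) ->
  (\int[mu]_(x in `[a, b]) (f x)%:E = (F b - F a)%:E)%E.
Proof.
rewrite le_eqVlt => /predU1P[->|ab] dF cf.
  by rewrite set_itv1 integral_set1 subrr.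
have cF x : a <= x <= b -> {for x, continuous F}.
  move=> xab; apply: differentiable_continuous; apply/derivable1_diffP.
  by have [df []] := dF x xab.
rewrite (@continuous_FTC2 _ f F a b ab) ?EFinB//.
- apply: continuous_in_subspaceT => x; rewrite inE/= in_itv/=; exact: cf.
- split.
  + by move=> x; rewrite in_itv/= => /andP[ax xb]; have [] := dF x; rewrite ?ltW.
  + by apply: cvg_at_right_filter; apply: cF; rewrite lexx ltW.
  + by apply: cvg_at_left_filter; apply: cF; rewrite lexx ltW.
- move=> x; rewrite in_itv/= => /andP[ax xb]; rewrite derive1E.
  by have [|df [_ ->]] := dF x; rewrite ?ltW.
Qed.

Lemma integral_sqrB (a b c : R) : a <= b ->
  (\int[mu]_(x in `[a, b[) ((x - c) ^+ 2)%:E = ((b - c) ^+ 3 / 3 - (a - c) ^+ 3 / 3)%:E)%E.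
Proof.
move=> ab; rewrite integral_itv_bndo_bndc; last first.
  by apply: measurable_funTS; apply/measurable_EFinP; apply: measurable_funX; exact: measurable_funB.
apply: (@FTC_cc (fun x => (x - c) ^+ 2) (fun x => (x - c) ^+ 3 / 3)) => //.
- move=> x _; rewrite (_ : (fun _ => _) = (3^-1 : R) \*: ((id - cst c) ^+ 3)); last first.
    by apply/funext => y /=; rewrite fctE /GRing.scale/= mulrC.
  eexists; first exact: is_deriveZ.
  by rewrite subr0 /GRing.scale/= !fctE; field.
- move=> x _; apply: (@continuous_comp _ _ _ (fun x => x - c) (fun x => x ^+ 2)).
    by apply: continuousB => //; exact: cst_continuous.
  exact: exprn_continuous.
Qed.

Lemma integral_cst_co (a b k : R) : a <= b ->
  (\int[mu]_(x in `[a, b[) k%:E = (k * (b - a))%:E)%E.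
Proof.
move=> ab; rewrite integral_cst//= EFinM; congr (_ * _)%E.
rewrite -[LHS]/(lebesgue_measure `[a, b[%classic) lebesgue_measure_itv/= lte_fin.
by move: ab; rewrite le_eqVlt => /predU1P[->|->]//; rewrite ltxx subrr.
Qed.

(** Meant for integrands that are singular or not differentiable at the left end: the interval is
    exhausted by [[a + (b - a)/(n + 1), b]], and monotone convergence reduces the claim to the right
    limit of [F] at [a]. *)
Lemma ge0_FTC_oc (f F : R -> R) (a b l : R) : a < b ->
  (forall x, a < x <= b -> 0 <= f x) ->
  (forall x, a < x <= b -> exists2 df, is_derive x 1 F df & df = f x) ->
  (forall x, a < x <= b -> {for x, continuous f}) ->
  F x @[x --> a^'+] --> l ->
  (\int[mu]_(x in `]a, b]) (f x)%:E = (F b - l)%:E)%E.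
Proof.
move=> ab f0 dF cf Fl.
pose e n := a + (b - a) / n.+1%:R.
have ba : 0 < b - a by rewrite subr_gt0.
have e_gt n : a < e n by rewrite /e ltrDl divr_gt0.
have e_le n : e n <= b.
  by rewrite /e -lerBrDl ler_pdivrMr// -[leLHS]mulr1 ler_pM2l// ler1n.
pose A n : set R := `[e n, b]%classic.
have bigA : \bigcup_n A n = `]a, b]%classic.
  apply/seteqP; split => [x [n _]|x]; rewrite /A /= !in_itv/=.
    by move=> /andP[ex ->]; rewrite (lt_le_trans (e_gt n)).
  move=> /andP[ax xb].
  have xa : 0 < x - a by rewrite subr_gt0.
  have [n nP] : exists n : nat, (b - a) / (x - a) < n%:R.
    by exists (Num.trunc ((b - a) / (x - a))).+1; rewrite truncnS_gt.
  exists n => //=; rewrite in_itv/= xb andbT /e -lerBrDl.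
  rewrite ler_pdivrMr// mulrC -ler_pdivrMr//.
  by rewrite (le_trans (ltW nP))// ler_nat.
have mA n : measurable (A n) by exact: measurable_itv.
have mfA n : measurable_fun (A n) (EFin \o f).
  apply/measurable_EFinP; apply: subspace_continuous_measurable_fun => //.
  apply: continuous_in_subspaceT => x /set_mem; rewrite /A/= in_itv/= => /andP[ex xb].
  by apply: cf; rewrite xb (lt_le_trans (e_gt n)).
have cvg1 : (\int[mu]_(x in A i) (f x)%:E @[i --> \oo] --> \int[mu]_(x in \bigcup_i A i) (f x)%:E)%E.
  apply: ge0_nondecreasing_set_cvg_integral => //.
  - move=> m n mn; apply/subsetPset => x; rewrite /A/= !in_itv/= => /andP[ex ->].
    rewrite andbT (le_trans _ ex)// /e lerD2l ler_pM2l// lef_pV2 ?posrE//.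
    by rewrite ler_nat.
  - move=> n x; rewrite /A/= in_itv/= => /andP[ex xb].
    by rewrite lee_fin f0// xb (lt_le_trans (e_gt n)).
rewrite -bigA; apply: (@cvg_unique _ (@ereal_hausdorff R) _ _ _ _ cvg1).
have -> : (fun n => \int[mu]_(x in A n) (f x)%:E)%E = (fun n => (F b - F (e n))%:E).
  apply/funext => n; apply: FTC_cc => // x /andP[ex xb].
    by apply: dF; rewrite xb (lt_le_trans (e_gt n)).
  by apply: cf; rewrite xb (lt_le_trans (e_gt n)).
apply: cvg_EFin; first by near=> n.
apply: cvgB; first exact: cvg_cst.
move/cvg_at_rightP : Fl => /(_ e); apply; split => //.
rewrite -[X in _ --> X]addr0 -(mulr0 (b - a)) /e.
apply: cvgD; first exact: cvg_cst.
by apply: cvgM; [exact: cvg_cst|exact: cvg_harmonic].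
Unshelve. all: by end_near. Qed.

(* Length of ]0, d[ `&` [y, y + h]. *)
Definition overlap (d h y : R) : R :=
  Num.max 0 (Num.min (Num.min d h) (Num.min (y + h) (d - y))).

(** The graph of [overlap d h] is a trapezoid of height [min d h], with two ramps of slope one in
    absolute value and a plateau of width [max d h - min d h]; this is the integral of its
    square. *)
Definition overlap_energy (d h : R) : R :=
  2 * Num.min d h ^+ 3 / 3 + (Num.max d h - Num.min d h) * Num.min d h ^+ 2.

Lemma overlap_ge0 d h y : 0 <= overlap d h y.
Proof. by rewrite le_max lexx. Qed.

Lemma overlap_out d h y : y <= - h \/ d <= y -> overlap d h y = 0.
Proof.
move=> H; apply/max_idPl; rewrite !ge_min.
by case: H => H; apply/orP; right; apply/orP; [left|right]; lra.
Qed.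

Lemma measurable_overlap d h : measurable_fun [set: R] (overlap d h).
Proof.
apply: measurable_maxr => //; apply: measurable_minr => //; apply: measurable_minr.
  exact: measurable_funD.
exact: measurable_funB.
Qed.

Lemma integral_overlap_sqr d h : 0 < d -> 0 < h ->
  (\int[mu]_(y in `[(- h)%R, d[) ((overlap d h y) ^+ 2)%:E = (overlap_energy d h)%:E)%E.
Proof.
move=> d0 h0; rewrite /overlap_energy.
set m := Num.min d h; set M := Num.max d h.
have mM : m <= M by rewrite /m /M ge_min le_max lexx.
have mMdh : m + M = d + h by rewrite addr_min_max.
have m0 : 0 < m by rewrite lt_min d0 h0.
have mf : measurable_fun [set: R] (fun y => ((overlap d h y) ^+ 2)%:E).
  by apply/measurable_EFinP; apply: measurable_funX; exact: measurable_overlap.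
have f0 y : (0 <= ((overlap d h y) ^+ 2)%:E)%E by rewrite lee_fin sqr_ge0.
(* The cuts are the corners of the trapezoid: rising ramp up to [m - h], plateau up to [d - m],
   falling ramp up to [d]. *)
rewrite (@ge0_integral_co_split _ (- h) (m - h)) ?lerDr//; [|lra|lra].
rewrite (@ge0_integral_co_split _ (m - h) (d - m))//; [|lra|lra].
have -> : (\int[mu]_(y in `[(- h)%R, (m - h)%R[) ((overlap d h y) ^+ 2)%:E =
           \int[mu]_(y in `[(- h)%R, (m - h)%R[) ((y - (- h)) ^+ 2)%:E)%E.
  apply: eq_integral => y; rewrite inE/= in_itv/= => /andP[y1 y2].
  rewrite /overlap -/m opprK (min_idPr _); last by rewrite ge_min; apply/orP; left; lra.
  rewrite (min_idPl _); last lra.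
  by rewrite (max_idPr _)//; lra.
rewrite integral_sqrB; last lra.
have -> : (\int[mu]_(y in `[(m - h)%R, (d - m)%R[) ((overlap d h y) ^+ 2)%:E =
           \int[mu]_(y in `[(m - h)%R, (d - m)%R[) (m ^+ 2)%:E)%E.
  apply: eq_integral => y; rewrite inE/= in_itv/= => /andP[y1 y2].
  rewrite /overlap -/m (min_idPl _); last by rewrite le_min; apply/andP; split; lra.
  by rewrite (max_idPr _)//; lra.
rewrite integral_cst_co; last lra.
have -> : (\int[mu]_(y in `[(d - m)%R, d[) ((overlap d h y) ^+ 2)%:E =
           \int[mu]_(y in `[(d - m)%R, d[) ((y - d) ^+ 2)%:E)%E.
  apply: eq_integral => y; rewrite inE/= in_itv/= => /andP[y1 y2].
  rewrite /overlap -/m (min_idPr _); last by rewrite ge_min; apply/orP; right; lra.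
  rewrite (min_idPr _); last lra.
  by rewrite (max_idPr _) -1?sqrrN ?opprB//; lra.
rewrite integral_sqrB; last lra.
rewrite -!EFinD; congr (_%:E).
have -> : M = d + h - m by lra.
by field.
Qed.

Lemma powR_continuous (r x : R) : 0 < x -> {for x, continuous (fun y => y `^ r)}.
Proof.
move=> x0; apply: differentiable_continuous; apply/derivable1_diffP.
by apply: derivable_powR; rewrite in_itv/= x0.
Qed.

Lemma powR_continuous_MB (c1 c2 r1 r2 x : R) : 0 < x ->
  {for x, continuous (fun y => c1 * y `^ r1 + c2 * y `^ r2)}.
Proof.
move=> x0; apply: continuousD; apply: continuousM;
  by [exact: cst_continuous|exact: powR_continuous].
Qed.

Lemma powR_derive_MB (c1 c2 r1 r2 x : R) : 0 < x ->
  is_derive x 1 (fun y => c1 * y `^ r1 + c2 * y `^ r2)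
   (c1 * (r1 * x `^ (r1 - 1)) + c2 * (r2 * x `^ (r2 - 1))).
Proof.
move=> x0; apply: is_deriveD; apply: (@is_deriveZ _ _ _ (fun y => y `^ _)); exact: is_derive1_powR.
Qed.

Lemma ln_powR_derive (c1 c2 r2 x : R) : 0 < x ->
  is_derive x 1 (fun y => c1 * ln y + c2 * y `^ r2)
   (c1 * x^-1 + c2 * (r2 * x `^ (r2 - 1))).
Proof.
move=> x0; apply: is_deriveD; first by apply: (@is_deriveZ _ _ _ (@ln R)); exact: is_derive1_ln.
by apply: (@is_deriveZ _ _ _ (fun y => y `^ _)); exact: is_derive1_powR.
Qed.
End Primitives.

(** * Kernel integrals *)

Section Kernel.
Context {R : realType}.
Local Notation mu := (@lebesgue_measure R).

Lemma exprn_mul_powR (n : nat) (h r : R) : 0 < h -> h ^+ n * h `^ r = h `^ (n%:R + r).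
Proof.
move=> h0; rewrite powRD; last by rewrite (gt_eqF h0) implybT.
by rewrite powR_mulrn// ltW.
Qed.

(** Cost, per unit of [T], of adding [T h^2] to the increment energy for [h <= 1]. The primitive
    [h^(2 - 2s)/(2 - 2s)] vanishes at [0] because [s < 1]. *)
Lemma integral_sqr_powR (s : R) : s < 1 ->
  (\int[mu]_(h in `]0%R, 1%R]) (h ^+ 2 * h `^ (- (1 + 2 * s)))%:E = ((2 - 2 * s)^-1)%:E)%E.
Proof.
move=> s1; have r0 : 2 - 2 * s != 0 by rewrite gt_eqF//; lra.
have -> : (\int[mu]_(h in `]0%R, 1%R]) (h ^+ 2 * h `^ (- (1 + 2 * s)))%:E =
  \int[mu]_(h in `]0%R, 1%R]) (h `^ (1 - 2 * s))%:E)%E.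
  apply: eq_integral => h; rewrite inE/= in_itv/= => /andP[h0 _].
  by rewrite exprn_mul_powR//; congr (_ `^ _)%:E; ring.
etransitivity; [apply: (@ge0_FTC_oc _ (fun h => h `^ (1 - 2 * s)) (fun h => (2 - 2 * s)^-1 * h `^ (2 - 2 * s)) 0 1 0) => //|].
- by move=> x _; exact: powR_ge0.
- move=> x /andP[x0 _]; eexists.
    by apply: (@is_deriveZ _ _ _ (fun y => y `^ _)); exact: is_derive1_powR.
  by rewrite /GRing.scale/= mulKf//; congr (_ `^ _); ring.
- by move=> x /andP[x0 _]; exact: powR_continuous.
- rewrite -[X in _ --> X](mulr0 (2 - 2 * s)^-1); apply: cvgM; first exact: cvg_cst.
  by apply: powR_cvg0; lra.
- by rewrite /= powR1 mulr1 subr0.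
Qed.

(** For [h >= 1] and [s >= 1/2] the integrand is at most [h^-2], whose integral is [1]. *)
Lemma integral_powR_tail (s : R) : 2^-1 <= s ->
  (\int[mu]_(h in `]1%R, +oo[) (h `^ (- (1 + 2 * s)))%:E <= 1)%E.
Proof.
move=> s2.
have cV x : 1 <= x -> {for x, continuous (fun h : R => h `^ (- 2))}.
  by move=> x1; apply: powR_continuous; lra.
apply: (@le_trans _ _ (\int[mu]_(h in `[1%R, +oo[) (h `^ (- 2))%:E)%E).
  rewrite integral_itv_obnd_cbnd; last first.
    by apply: measurable_funTS; apply/measurable_EFinP; exact: measurable_powR.
  apply: ge0_le_integral => //.
  - by move=> x _; rewrite lee_fin powR_ge0.
  - by apply: measurable_funTS; apply/measurable_EFinP; exact: measurable_powR.
  - by apply: measurable_funTS; apply/measurable_EFinP; exact: measurable_powR.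
  - move=> x; rewrite /= in_itv/= andbT => x1; rewrite lee_fin.
    by apply: ler_powR => //; lra.
rewrite [leLHS](_ : _ = 1%E)//; etransitivity; [apply: (@ge0_continuous_FTC2y _ (fun h => h `^ (-2)) (fun h => - h `^ (- 1)) 1 0) => //|].
- by move=> x _; exact: powR_ge0.
- apply: continuous_in_subspaceT => x /set_mem/=; rewrite in_itv/= andbT; exact: cV.
- rewrite -oppr0; apply: cvgN.
  apply: (@cvg_trans _ ((fun x : R => x^-1) @ +oo)).
    apply: near_eq_cvg; near=> x; rewrite powR_inv1//.
  apply/gtr0_cvgV0; last exact: cvg_id.
  by near=> x.
- move=> x x1; apply: derivableN; apply: derivable_powR; rewrite in_itv/= andbT; lra.
- apply: cvg_at_right_filter; apply: cvgN; apply: powR_continuous; lra.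
- move=> x; rewrite in_itv/= andbT => x1; rewrite derive1E.
  have x0 : 0 < x by lra.
  have [_ ->] : is_derive x 1 (fun h => - h `^ (- 1)) (- (- 1 * x `^ (- 1 - 1))).
    by apply: is_deriveN; exact: is_derive1_powR.
  rewrite mulN1r opprK; congr (_ `^ _); ring.
- by rewrite /= powR1 -EFinB opprK add0r.
Unshelve. all: by end_near. Qed.

Lemma measurable_overlap_energy (d : R) : measurable_fun [set: R] (overlap_energy d).
Proof.
have mmin : measurable_fun [set: R] (Num.min d) by exact: measurable_minr.
apply: measurable_funD.
  apply: measurable_funM => //; apply: measurable_funM => //.
  exact: measurable_funX.
apply: measurable_funM; last exact: measurable_funX.
apply: measurable_funB => //; exact: measurable_maxr.
Qed.

Lemma overlap_energy_ge0 (d h : R) : 0 <= d -> 0 <= h -> 0 <= overlap_energy d h.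
Proof.
move=> d0 h0; have m0 : 0 <= Num.min d h by rewrite le_min d0.
by rewrite addr_ge0 ?mulr_ge0 ?exprn_ge0// subr_ge0 ge_min le_max lexx.
Qed.

(** The kernel integral of [overlap_energy d] over []0, 1]], divided by [d^2], is [sigma_scale s d]
    plus this remainder, which stays bounded as [d] tends to [0]. For [s > 1/2] its two terms are
    the contributions of the upper limit [h = 1]. *)
Definition energy_correction (s d : R) : R :=
  if s == 2^-1 then 2^-1 + d / 3 else d / (6 * s) - (2 * s - 1)^-1.

(** For [h <= d] the overlap energy is [d h^2 - h^3/3], so the integrand is a combination of two
    powers whose primitives vanish at [0] because [s < 1]. *)
Lemma integral_overlap_near (s d : R) : 2^-1 <= s -> s < 1 -> 0 < d ->
  (\int[mu]_(h in `]0%R, d]) (overlap_energy d h * h `^ (- (1 + 2 * s)))%:E =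
    (d ^+ 2 * (d `^ (1 - 2 * s) * ((2 - 2 * s)^-1 - (3 * (3 - 2 * s))^-1)))%:E)%E.
Proof.
move=> s2 s1 d0.
have r0 : 2 - 2 * s != 0 by rewrite gt_eqF//; lra.
have r1 : 3 - 2 * s != 0 by rewrite gt_eqF//; lra.
pose f h := d * h `^ (1 - 2 * s) + (- 3^-1) * h `^ (2 - 2 * s).
have fE h : 0 < h <= d -> overlap_energy d h * h `^ (- (1 + 2 * s)) = f h.
  move=> /andP[h0 hd]; rewrite /f /overlap_energy (min_idPr hd) (max_idPl hd).
  have -> : 1 - 2 * s = 2%:R + (- (1 + 2 * s)) by ring.
  have -> : 2 - 2 * s = 3%:R + (- (1 + 2 * s)) by ring.
  by rewrite -!exprn_mul_powR//; field.
have -> : (\int[mu]_(h in `]0%R, d]) (overlap_energy d h * h `^ (- (1 + 2 * s)))%:E =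
  \int[mu]_(h in `]0%R, d]) (f h)%:E)%E.
  by apply: eq_integral => h; rewrite inE/= in_itv/= => hd; rewrite fE.
etransitivity; [apply: (@ge0_FTC_oc _ f (fun h => d / (2 - 2 * s) * h `^ (2 - 2 * s) +
   (- 3^-1 / (3 - 2 * s)) * h `^ (3 - 2 * s)) 0 d 0) => //|].
- move=> x xd; rewrite -fE// mulr_ge0 ?powR_ge0 ?overlap_energy_ge0//; lra.
- move=> x /andP[x0 _]; eexists; first exact: powR_derive_MB.
  rewrite /f; congr (_ + _); rewrite mulrA divfK//; congr (_ * _ `^ _); ring.
- by move=> x /andP[x0 _]; exact: powR_continuous_MB.
- rewrite -[X in _ --> X](addr0 0); apply: cvgD.
    rewrite -[X in _ --> X](mulr0 (d / (2 - 2 * s))); apply: cvgM; first exact: cvg_cst.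
    by apply: powR_cvg0; lra.
  rewrite -[X in _ --> X](mulr0 (- 3^-1 / (3 - 2 * s))); apply: cvgM; first exact: cvg_cst.
  by apply: powR_cvg0; lra.
- congr (_%:E); rewrite subr0.
  have -> : 2 - 2 * s = 1%:R + (1 - 2 * s) by ring.
  have -> : 3 - 2 * s = 2%:R + (1 - 2 * s) by ring.
  rewrite -!exprn_mul_powR//; field.
  by apply/andP; split; [move: r1|move: r0]; congr (_ != _); ring.
Qed.

(** For [h >= d] the overlap energy is [d^2 h - d^3/3]. The leading term [d^2 h^(-2s)] of the
    integrand has a logarithm as primitive exactly when [s = 1/2]: this is the source of the two
    regimes of [sigma_scale]. *)
Lemma integral_overlap_far (s d : R) : 2^-1 <= s -> s < 1 -> 0 < d -> d < 1 ->
  (\int[mu]_(h in `]d, 1%R]) (overlap_energy d h * h `^ (- (1 + 2 * s)))%:E =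
   (d ^+ 2 * ((if s == 2^-1 then ln (d^-1) else (d `^ (1 - 2 * s) - 1) / (2 * s - 1))
      + d / (6 * s) - d `^ (1 - 2 * s) / (6 * s)))%:E)%E.
Proof.
move=> s2 s1 d0 d1.
have s0 : s != 0 by rewrite gt_eqF//; lra.
pose f h := d ^+ 2 * h `^ (- (2 * s)) + (- (d ^+ 3 / 3)) * h `^ (- (1 + 2 * s)).
have fE h : d < h <= 1 -> overlap_energy d h * h `^ (- (1 + 2 * s)) = f h.
  move=> /andP[hd h1]; have dh := ltW hd.
  have h0 : 0 < h by lra.
  rewrite /f /overlap_energy (min_idPl dh) (max_idPr dh).
  have -> : - (2 * s) = 1%:R + (- (1 + 2 * s)) by ring.
  by rewrite -!exprn_mul_powR//; field.
have -> : (\int[mu]_(h in `]d, 1%R]) (overlap_energy d h * h `^ (- (1 + 2 * s)))%:E =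
  \int[mu]_(h in `]d, 1%R]) (f h)%:E)%E.
  by apply: eq_integral => h; rewrite inE/= in_itv/= => hd; rewrite fE.
have dq : d `^ (- (2 * s)) = d `^ (1 - 2 * s) / d.
  have -> : 1 - 2 * s = 1%:R + (- (2 * s)) by ring.
  by rewrite -exprn_mul_powR// mulrAC expr1 divff ?mul1r// gt_eqF.
have dN0 : d != 0 by rewrite gt_eqF.
have f0 x : d < x <= 1 -> 0 <= f x.
  move=> xd; rewrite -fE// mulr_ge0 ?powR_ge0 ?overlap_energy_ge0//; lra.
have cf x : d < x <= 1 -> {for x, continuous f}.
  by move=> /andP[dx _]; apply: powR_continuous_MB; lra.
have [sE|sN] := eqVneq s 2^-1.
  pose F h := d ^+ 2 * ln h + (d ^+ 3 / 3 / (2 * s)) * h `^ (- (2 * s)).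
  have dF x : d <= x -> exists2 df, is_derive x 1 F df & df = f x.
    move=> dx; have x0 : 0 < x by lra.
    eexists; first exact: ln_powR_derive.
    rewrite /f; congr (_ + _).
      by rewrite sE divff// powR_inv1// ltW.
    have -> : - (2 * s) - 1 = - (1 + 2 * s) by ring.
    by field.
  etransitivity; [apply: (@ge0_FTC_oc _ f F d 1 (F d)) => //|].
  - by move=> x /andP[/ltW/dF].
  - apply: cvg_at_right_filter; apply: differentiable_continuous; apply/derivable1_diffP.
    by have [df []] := dF d (lexx _).
  - congr (_%:E); rewrite /F powR1 ln1 dq lnV ?posrE//; field.
    by rewrite s0.
have r1 : 2 * s - 1 != 0 by rewrite subr_eq0; apply: contra sN => /eqP h; apply/eqP; lra.
have r2 : 1 - 2 * s != 0 by rewrite -oppr_eq0 opprB.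
pose F h := d ^+ 2 / (1 - 2 * s) * h `^ (1 - 2 * s) + (d ^+ 3 / 3 / (2 * s)) * h `^ (- (2 * s)).
have dF x : d <= x -> exists2 df, is_derive x 1 F df & df = f x.
  move=> dx; have x0 : 0 < x by lra.
  eexists; first exact: powR_derive_MB.
  rewrite /f; congr (_ + _).
    by rewrite mulrA divfK//; congr (_ * _ `^ _); ring.
  have -> : - (2 * s) - 1 = - (1 + 2 * s) by ring.
  by field.
etransitivity; [apply: (@ge0_FTC_oc _ f F d 1 (F d)) => //|].
- by move=> x /andP[/ltW/dF].
- apply: cvg_at_right_filter; apply: differentiable_continuous; apply/derivable1_diffP.
  by have [df []] := dF d (lexx _).
- congr (_%:E); rewrite /F !powR1 dq; field.
  by rewrite s0 dN0 r1 r2.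
Qed.

(** Origin of the constant in [sigma_scale]: for [s > 1/2] the coefficients of [d^(1 - 2s)] from the
    two ranges add up to [1/(2 - 2s) - 1/(3(3 - 2s)) + 1/(2s - 1) - 1/(6s)], which equals
    [1/(2s(1 - s)(2s - 1)(3 - 2s))]. At [s = 1/2] that power is [1], and the logarithm is
    accompanied by [1 - 1/6 - 1/3 = 1/2]. *)
Lemma integral_overlap_energy (s d : R) : 2^-1 <= s -> s < 1 -> 0 < d -> d < 1 ->
  (\int[mu]_(h in `]0%R, 1%R]) (overlap_energy d h * h `^ (- (1 + 2 * s)))%:E =
   (d ^+ 2 * (sigma_scale s d + energy_correction s d))%:E)%E.
Proof.
move=> s2 s1 d0 d1.
have -> : `]0%R, 1%R]%classic = `]0%R, d]%classic `|` `]d, 1%R]%classic :> set R.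
  apply/seteqP; split => x /=; rewrite !in_itv/=.
    by move=> /andP[x0 x1]; case: (leP x d) => xd; [left|right]; rewrite ?x0.
  by move=> [] /andP[x0 x1]; apply/andP; split; lra.
have mw : measurable_fun [set: R] (fun h => (overlap_energy d h * h `^ (- (1 + 2 * s)))%:E).
  apply/measurable_EFinP; apply: measurable_funM; last exact: measurable_powR.
  exact: measurable_overlap_energy.
rewrite ge0_integral_setU//; last 3 first.
- exact: measurable_funTS.
- move=> x xI; rewrite lee_fin mulr_ge0 ?powR_ge0 ?overlap_energy_ge0 ?(ltW d0)//.
  by case: xI; rewrite /= in_itv/= => /andP[]; lra.
- apply/disj_setPS => x /=; rewrite !in_itv/=; lra.
rewrite integral_overlap_near// integral_overlap_far// -EFinD; congr (_%:E).
have s0 : s != 0 by rewrite gt_eqF//; lra.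
have r0 : 2 - 2 * s != 0 by rewrite gt_eqF//; lra.
have r3 : 1 - s != 0 by rewrite gt_eqF//; lra.
have r1 : 3 - 2 * s != 0 by rewrite gt_eqF//; lra.
rewrite /sigma_scale /energy_correction; have [->|sN] := eqVneq s 2^-1.
  have -> : (2 - 2 * 2^-1 : R)^-1 = 1 by field.
  have -> : (3 * (3 - 2 * 2^-1) : R)^-1 = 6^-1 by field.
  by rewrite divff// subrr powRr0; field.
have r4 : 2 * s - 1 != 0 by rewrite subr_eq0; apply: contra sN => /eqP h; apply/eqP; lra.
field.
by rewrite s0 r0 r1 r3 r4.
Qed.
End Kernel.

(** * Increments of admissible functions *)

Section Admissible.
Context {R : realType}.
Local Notation mu := (@lebesgue_measure R).
Implicit Types (u : R -> R) (T Lambda delta : R).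

Lemma integral_itv_addr (c a b : R) (b1 b2 : bool) (f : R -> \bar R) :
  measurable_fun [set: R] f ->
  (\int[mu]_(x in [set` Interval (BSide b1 a) (BSide b2 b)]) f (x + c)%R =
  \int[mu]_(x in [set` Interval (BSide b1 (a + c)%R) (BSide b2 (b + c)%R)]) f x)%E.
Proof.
move=> mf; rewrite integralE [RHS]integralE; congr (_ - _)%E.
  by rewrite -(@ge0_integral_itv_addr _ c a b b1 b2 f^\+%E)//;
    [by apply: eq_integral => x _; rewrite !funeposE|exact: measurable_funepos].
by rewrite -(@ge0_integral_itv_addr _ c a b b1 b2 f^\-%E)//;
  [by apply: eq_integral => x _; rewrite !funenegE|exact: measurable_funeneg].
Qed.

Lemma continuous_integrable_co (f : R -> R) (a b : R) : continuous f ->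
  mu.-integrable `[a, b[ (EFin \o f).
Proof.
move=> cf.
suff : mu.-integrable `[a, b] (EFin \o f).
  by apply: integrableS => //; exact: subset_itv_co_cc.
apply: continuous_compact_integrable; first exact: segment_compact.
exact: continuous_subspaceT.
Qed.

(* Subtracting an increment from [h] costs no cross term, as increments of a periodic
   function have mean zero. *)
Lemma integral_sqr_subincrement (u : R -> R) (T h : R) : 0 < T -> continuous u ->
  (forall x, u (x + T) = u x) ->
  (\int[mu]_(x in `[0%R, T[) ((h - (u (x + h) - u x)) ^+ 2)%:E =
   increment_energy T u h + (T * h ^+ 2)%:E)%E.
Proof.
move=> T0 cu uT.
have cuh : continuous (fun x => u (x + h)).
  move=> x; apply: (@continuous_comp _ _ _ (fun x => x + h) u); last exact: cu.
  by apply: continuousD => //; exact: cst_continuous.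
pose w x := u (x + h) - u x.
have cw : continuous w by move=> x; apply: continuousB; [exact: cuh|exact: cu].
have iw : mu.-integrable `[0, T[ (EFin \o w) by exact: continuous_integrable_co.
have mu_ : measurable_fun [set: R] (EFin \o u).
  by apply/measurable_EFinP; exact: continuous_measurable_fun.
have w0 : (\int[mu]_(x in `[0%R, T[) (w x)%:E = 0)%E.
  under eq_integral do rewrite EFinB.
  rewrite integralB_EFin//; [|exact: continuous_integrable_co|exact: continuous_integrable_co].
  rewrite (@integral_itv_addr h 0 T true true (EFin \o u))// add0r [(T + h)%R]addrC.
  rewrite integral_periodic//; last by move=> x /=; rewrite uT.
  rewrite subee//; apply: integrable_fin_num => //; exact: continuous_integrable_co.
have iw2 : mu.-integrable `[0, T[ (EFin \o (fun x => w x ^+ 2)).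
  apply: continuous_integrable_co => x.
  by apply: (@continuous_comp _ _ _ w (fun y => y ^+ 2)); [exact: cw|exact: exprn_continuous].
have -> : (\int[mu]_(x in `[0%R, T[) ((h - (u (x + h) - u x)) ^+ 2)%:E =
  \int[mu]_(x in `[0%R, T[) ((h ^+ 2)%:E + (- (2 * h))%:E * (w x)%:E + (w x ^+ 2)%:E))%E.
  by apply: eq_integral => x _; rewrite -EFinM -!EFinD; congr (_%:E); rewrite /w; ring.
have ic : mu.-integrable `[0, T[ (EFin \o cst (h ^+ 2)).
  by apply: continuous_integrable_co; exact: cst_continuous.
rewrite integralD//; last first.
  apply: integrableD => //; exact: integrableZl.
rewrite integralD//; last exact: integrableZl.
rewrite integralZl// w0 mule0 adde0 integral_cst_co ?ltW// subr0 addeC; congr (_ + _)%E.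
by rewrite mulrC.
Qed.

Lemma affine_derive u (al be a b : R) x : (forall y, a <= y <= b -> u y = al * y + be) ->
  a < x < b -> is_derive x 1 u al.
Proof.
move=> ub /andP[ax xb].
have near_u : {near x, (fun y => al * y + be) =1 u}.
  near=> y; rewrite ub//; apply/andP; split; apply: ltW; near: y.
    exact: lt_nbhsr.
  exact: lt_nbhsl.
have da : is_derive x 1 (fun y : R => al * y + be) al.
  have := is_deriveD (is_deriveZ al (is_derive_id x (1 : R))) (is_derive_cst be x 1).
  by rewrite addr0 /GRing.scale/= mulr1.
case: da => d1 d2; split.
  exact: (near_eq_derivable near_u).
by rewrite -d2; apply/esym/near_eq_derive.
Unshelve. all: by end_near. Qed.

(** An interval of positive length cannot lie inside the null exceptional set, so some interior
    point has an allowed derivative, which there equals [al]. *)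
Lemma affine_slope u Lambda (al be a b : R) : a < b ->
  {ae mu, forall x, derivable u x 1 /\ (derive1 u x = 1 \/ derive1 u x = - Lambda)} ->
  (forall y, a <= y <= b -> u y = al * y + be) -> al = 1 \/ al = - Lambda.
Proof.
move=> ab [N [mN N0 PN]] ub.
have [x xab Nx] : exists2 x, a < x < b & ~ N x.
  apply: contrapT => H.
  have sub : `]a, b[%classic `<=` N.
    move=> x; rewrite /= in_itv/= => xab; apply: contrapT => Nx; apply: H; by exists x.
  have : (mu `]a, b[%classic <= mu N)%E by apply: le_measure => //; rewrite inE.
  rewrite N0 lebesgue_measure_itv/= lte_fin ab -EFinB lee_fin; lra.
have /contrapT [_] := contra_not (PN x) Nx.
by rewrite derive1E; have [_ ->] := affine_derive ub xab.
Qed.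

Lemma setI_itv_co_split (D : set R) (a b c : R) : measurable D -> a <= b -> b <= c ->
  (mu (D `&` `[a, c[%classic) = mu (D `&` `[a, b[%classic) + mu (D `&` `[b, c[%classic))%E.
Proof.
move=> mD ab bc; rewrite (itv_co_split ab bc) setIUr measureU//.
- exact: measurableI.
- exact: measurableI.
- apply/seteqP; split => // x [[_ +] [_ +]]; rewrite /= !in_itv/= => /andP[_ xb] /andP[bx _]; lra.
Qed.

Lemma admissible_measurable T Lambda delta u : admissible T Lambda delta u ->
  measurable (neg_slope_set u Lambda).
Proof.
move=> [_ _ _ _ [a [b1 [b2 [-> _]]]]]; apply: bigcup_measurable => k _.
exact: measurable_itv.
Qed.

(** Telescoping over the affine pieces: [x - u x] is constant where the slope is [1] and has slope
    [1 + Lambda] where it is [- Lambda]. Whether a breakpoint belongs to the descending set does not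
    matter, points being null. *)
Lemma admissible_increment T Lambda delta u x y : 0 < Lambda -> admissible T Lambda delta u ->
  x <= y -> (((y - u y) - (x - u x))%:E =
    (1 + Lambda)%:E * mu (neg_slope_set u Lambda `&` `[x, y[%classic))%E.
Proof.
move=> L0 adm; have mD := admissible_measurable adm.
case: adm => [_ _ pu aeu _].
rewrite le_eqVlt => /predU1P[->|xy].
  by rewrite subrr set_itvco0 setI0 measure0 mule0.
have [m [t [<- <- tlt tu]]] := pu x y xy.
have tle i j : (i <= j)%N -> (j <= m)%N -> t i <= t j.
  elim: j => [|j IH]; first by rewrite leqn0 => /eqP ->.
  rewrite leq_eqVlt => /predU1P[->//|ij jm].
  by rewrite (le_trans (IH _ (ltnW jm)))// ltW// tlt.
have {x y xy} : (m <= m)%N by [].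
elim: {-2}m => [|i IH] im.
  by rewrite subrr set_itvco0 setI0 measure0 mule0.
rewrite (@setI_itv_co_split _ _ (t i))//; [|exact: tle (ltnW im)|exact/ltW/tlt].
rewrite ge0_muleDr// -IH; last exact: ltnW.
have [al [be ab]] := tu i im.
have ti := tlt i im.
have ui : u (t i) = al * t i + be by rewrite ab// lexx ltW.
have uj : u (t i.+1) = al * t i.+1 + be by rewrite ab// lexx ltW.
have -> : (mu (neg_slope_set u Lambda `&` `[t i, t i.+1[%classic) =
    ((1 - al) * (t i.+1 - t i) / (1 + Lambda))%:E)%E.
  case: (affine_slope ti aeu ab) => alE.
    rewrite alE subrr !mul0r; apply/eqP; rewrite eq_le measure_ge0 andbT.
    rewrite (@le_trans _ _ (mu [set t i]))//; last by rewrite lebesgue_measure_set1.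
    apply: le_measure; rewrite ?inE//; first exact: measurableI.
    move=> x [[_ dx]]; rewrite /= in_itv/= le_eqVlt => /andP[/predU1P[//|tx] xt].
    have xI : t i < x < t i.+1 by rewrite tx.
    by move: dx; rewrite derive1E; have [_ ->] := affine_derive ab xI; rewrite alE; lra.
  have -> : ((1 - al) * (t i.+1 - t i) / (1 + Lambda))%:E = (t i.+1 - t i)%:E.
    congr (_%:E); rewrite alE opprK; field; lra.
  apply/eqP; rewrite eq_le; apply/andP; split.
    rewrite (@le_trans _ _ (mu `[t i, t i.+1[%classic))//.
      by apply: le_measure; rewrite ?inE//; exact: measurableI.
    by rewrite lebesgue_measure_itv/= lte_fin ti.
  rewrite (@le_trans _ _ (mu `]t i, t i.+1[%classic))//.
    by rewrite lebesgue_measure_itv/= lte_fin ti.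
  apply: le_measure; rewrite ?inE//; first exact: measurableI.
  move=> x; rewrite /= in_itv/= => xI; split.
    by have [dx ex] := affine_derive ab xI; split => //; rewrite derive1E ex.
  by rewrite /= in_itv/=; case/andP: xI => /ltW -> ->.
rewrite -EFinM -EFinD; congr (_%:E); rewrite ui uj; field; lra.
Qed.
End Admissible.

(** * Lower bound *)

Section LowerBound.
Context {R : realType}.
Local Notation mu := (@lebesgue_measure R).
Implicit Types (u : R -> R) (T Lambda delta d h b x : R).

Lemma overlapE d h b x :
  overlap d h (x - b) = Num.max 0 (Num.min (b + d) (x + h) - Num.max b x).
Proof.
rewrite /overlap; congr (Num.max _ _).
case: (leP d h) => h1; case: (leP (x - b + h) (d - (x - b))) => h2;
case: (leP (b + d) (x + h)) => h3; case: (leP b x) => h4;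
by case: leP => h5; lra.
Qed.

Lemma lebesgue_measure_itv_max (b1 b2 : bool) (lo hi : R) :
  mu [set` Interval (BSide b1 lo) (BSide b2 hi)] = (Num.max 0 (hi - lo))%:E.
Proof.
rewrite lebesgue_measure_itv/= lte_fin; case: ltP => lohi.
  by rewrite (max_idPr _)// subr_ge0 ltW.
by rewrite (max_idPl _)// subr_le0.
Qed.

Lemma overlap_le_measure (A : set R) d h b x : measurable A -> `]b, b + d[%classic `<=` A ->
  ((overlap d h (x - b))%:E <= mu (A `&` `[x, (x + h)%R[%classic))%E.
Proof.
move=> mA bA; rewrite overlapE -(lebesgue_measure_itv_max false true).
apply: le_measure; rewrite ?inE//; first exact: measurableI.
move=> y; rewrite /= in_itv/= gt_max lt_min => /andP[/andP[by_ xy] /andP[yb yx]].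
by split; [apply: bA; rewrite /= in_itv/= by_ yb|rewrite /= in_itv/= (ltW xy)].
Qed.

Lemma measure_le_overlap (A : set R) d h b x : measurable A ->
  A `&` `[x, (x + h)%R[%classic `<=` `[b, b + d]%classic ->
  (mu (A `&` `[x, (x + h)%R[%classic) <= (overlap d h (x - b))%:E)%E.
Proof.
move=> mA bA; rewrite overlapE -(lebesgue_measure_itv_max true false).
apply: le_measure; rewrite ?inE//; first exact: measurableI.
move=> y [Ay yx]; have /= := bA y (conj Ay yx).
move: yx; rewrite /= !in_itv/= ge_max le_min => /andP[-> /ltW ->] /andP[-> ->].
by [].
Qed.

(** Stated for an arbitrary [A] so that the induction can remove the interval at [b] from it: by
    separation the remaining intervals still lie in the difference. *)
Lemma sum_overlap_le_measure (bs : seq R) (A : set R) d h x : measurable A ->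
  (forall b, b \in bs -> `]b, b + d[%classic `<=` A) ->
  pairwise (fun b b' => (b + d <= b') || (b' + d <= b)) bs ->
  ((\sum_(b <- bs) overlap d h (x - b))%:E <= mu (A `&` `[x, (x + h)%R[%classic))%E.
Proof.
elim: bs A => [|b bs IH] A mA bA /=; first by rewrite big_nil measure_ge0.
move=> /andP[/allP bP bsP]; rewrite big_cons EFinD.
pose I := `]b, b + d[%classic : set R.
have mI : measurable I by exact: measurable_itv.
have mW : measurable `[x, (x + h)%R[%classic by exact: measurable_itv.
rewrite (@measureDI _ _ _ mu (A `&` `[x, (x + h)%R[%classic) I)//; last exact: measurableI.
rewrite addeC; apply: leeD.
  have -> : A `&` `[x, (x + h)%R[%classic `\` I = (A `\` I) `&` `[x, (x + h)%R[%classic.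
    by apply/seteqP; split => y /= [[]].
  apply: IH => //; first exact: measurableD.
  move=> b' b's y yb'; split; first by apply: (bA b') => //; rewrite in_cons b's orbT.
  move: yb' => /=; rewrite /I /= !in_itv/= => /andP[y1 y2] /andP[y3 y4].
  by have /orP[] := bP _ b's; lra.
have -> : A `&` `[x, (x + h)%R[%classic `&` I = I `&` `[x, (x + h)%R[%classic.
  rewrite setIC setIA; congr (_ `&` _); apply/setIidPl.
  by apply: bA; rewrite in_cons eqxx.
exact: overlap_le_measure.
Qed.

(** The only loss is in the cross terms, so nothing is lost when at most one [c i] is nonzero, as
    happens for the overlaps of the sawtooth when [h <= 1]. *)
Lemma sum_sqr_le_sqr_sum (I : Type) (r : seq I) (c : I -> R) : (forall i, 0 <= c i) ->
  \sum_(i <- r) c i ^+ 2 <= (\sum_(i <- r) c i) ^+ 2.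
Proof.
move=> c0; elim: r => [|i r IH]; first by rewrite !big_nil expr0n.
by rewrite !big_cons sqrrD lerD// ?lerDl ?mulrn_wge0 ?mulr_ge0 ?sumr_ge0//.
Qed.

Lemma neg_slope_set_periodic u T Lambda x : (forall y, u (y + T) = u y) ->
  neg_slope_set u Lambda (x + T) = neg_slope_set u Lambda x.
Proof.
move=> uT; rewrite /neg_slope_set /= !derive1E /derive /derivable.
have -> // : (fun h : R => h^-1 *: ((u \o shift (x + T)) (h *: 1) - u (x + T))) =
  (fun h : R => h^-1 *: ((u \o shift x) (h *: 1) - u x)).
by apply/funext => h /=; rewrite addrA !uT.
Qed.

(** Otherwise both intervals contain []lo, hi[], whose two trisection points are distinct common
    points. *)
Lemma interval_intersection_sep (a a' d : R) (b1 b2 b1' b2' : bool) : 0 < d ->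
  (forall x y : R, [set` Interval (BSide b1 a) (BSide b2 (a + d))] x ->
     [set` Interval (BSide b1' a') (BSide b2' (a' + d))] x ->
     [set` Interval (BSide b1 a) (BSide b2 (a + d))] y ->
     [set` Interval (BSide b1' a') (BSide b2' (a' + d))] y -> x = y) ->
  (a + d <= a') || (a' + d <= a).
Proof.
move=> d0 H; apply/orP; case: (leP (a + d) a') => [|h1]; first by left.
case: (leP (a' + d) a) => [|h2]; first by right.
exfalso.
pose lo := Num.max a a'; pose hi := Num.min (a + d) (a' + d).
have lohi : lo < hi by rewrite /lo /hi gt_max !lt_min; apply/andP; split; apply/andP; split; lra.
have [la la' ha ha'] : [/\ a <= lo, a' <= lo, hi <= a + d & hi <= a' + d].
  by rewrite /lo /hi !le_max !ge_min !lexx ?orbT.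
have inI (z c : R) (e1 e2 : bool) : c < z < c + d -> z \in Interval (BSide e1 c) (BSide e2 (c + d)).
  by rewrite in_itv; case: e1 e2 => [] [] /= /andP[z1 z2]; rewrite ?z1 ?z2 ?(ltW z1) ?(ltW z2).
have := H (lo + (hi - lo) / 3) (lo + 2 * (hi - lo) / 3).
move=> /(_ _ _ _ _)/= E.
suff : lo + (hi - lo) / 3 = lo + 2 * (hi - lo) / 3 by lra.
by apply: E; apply: inI; apply/andP; split; lra.
Qed.

(** Over one period [u] returns to its value, so [x - u x] grows by [T] and the descending set has
    measure [T / (1 + 1/delta) = L delta] there. Covering this measure by intervals of length
    [delta] takes at least [L] of them. *)
Lemma admissible_periodic_intervals (L : nat) delta u : 0 < delta -> (0 < L)%N ->
  admissible (L%:R * (delta^-1 + 1) * delta) delta^-1 delta u ->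
  exists (x0 : R) (bs : seq R),
  [/\ (L <= size bs)%N,
      forall b, b \in bs -> [/\ x0 <= b, b + delta <= x0 + L%:R * (delta^-1 + 1) * delta &
          `]b, b + delta[%classic `<=` neg_slope_set u delta^-1] &
      pairwise (fun b b' => (b + delta <= b') || (b' + delta <= b)) bs].
Proof.
set T := L%:R * _ * delta => d0 L0 adm.
have TE : T = L%:R * (1 + delta) by rewrite /T; field; rewrite gt_eqF.
have L1 : (1 : R) <= L%:R by rewrite ler1n.
have Ld0 : 0 <= L%:R * delta by rewrite mulr_ge0// ltW.
have T0 : 0 < T by rewrite TE; lra.
have V0 : 0 < delta^-1 by rewrite invr_gt0.
have mD := admissible_measurable adm.
have incr := admissible_increment V0 adm.
have muD x : mu (neg_slope_set u delta^-1 `&` `[x, x + T[%classic) = (L%:R * delta)%:E.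
  have := incr x (x + T); rewrite lerDl => /(_ (ltW T0)).
  case: (adm) => _ uT _ _ _; rewrite uT.
  have -> : x + T - u x - (x - u x) = (1 + delta^-1) * (L%:R * delta).
    by rewrite TE; field; rewrite gt_eqF.
  move/(congr1 (mule ((1 + delta^-1)^-1)%:E)).
  have V1 : 1 + delta^-1 != 0 by rewrite gt_eqF//; lra.
  by rewrite muleA -!EFinM mulKf// mulVf// mul1e.
(* No descending interval straddles a point [x0] outside the descending set, nor its translate
   [x0 + T]: the period [x0, x0 + T] is cut between intervals. *)
have [x0 Dx0] : exists x0, ~ neg_slope_set u delta^-1 x0.
  apply: contrapT => H.
  have DT : neg_slope_set u delta^-1 = setT.
    by apply/seteqP; split => // x _; apply: contrapT => Dx; apply: H; exists x.
  have := muD 0; rewrite DT setTI lebesgue_measure_itv_max add0r subr0 TE => -[].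
  by rewrite (max_idPr _); [lra|lra].
have Dx0T : ~ neg_slope_set u delta^-1 (x0 + T).
  by rewrite neg_slope_set_periodic//; case: (adm).
case: (adm) => _ _ _ _ [a [b1 [b2 /= [DE sep]]]].
pose I k := [set` Interval (BSide (b1 k) (a k)) (BSide (b2 k) (a k + delta))].
have subI k : `]a k, a k + delta[%classic `<=` I k.
  move=> y; rewrite /I /= !in_itv; case: (b1 k) (b2 k) => [] [] /= /andP[y1 y2];
  by rewrite ?y1 ?y2 ?(ltW y1) ?(ltW y2).
have notin k z : ~ neg_slope_set u delta^-1 z -> (z <= a k) || (a k + delta <= z).
  move=> Dz; case: (leP z (a k)) => //= z1; case: leP => // z2; exfalso; apply: Dz.
  by rewrite DE; exists k => //; apply: subI; rewrite /= in_itv/= z1.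
pose S k := (x0 <= a k) && (a k + delta <= x0 + T).
(* Neither end of the period is interior to a descending interval, so an interval that is not
   contained in [[x0, x0 + T]] meets it at most in an endpoint. *)
have muI k : (mu (I k `&` `[x0, (x0 + T)%R[%classic) <= (if S k then delta else 0)%:E)%E.
  have [Sk|/negP Sk] := boolP (S k).
    rewrite (@le_trans _ _ (mu (I k)))//.
      by apply: le_measure; rewrite ?inE; [apply: measurableI|..]; try exact: measurable_itv; exact: subIsetl.
    by rewrite /I lebesgue_measure_itv_max addrC addKr (max_idPr _)// ltW.
  rewrite (@le_trans _ _ (mu `[Num.max x0 (a k), Num.min (x0 + T) (a k + delta)]%classic))//.
    apply: le_measure; rewrite ?inE; [apply: measurableI|..]; try exact: measurable_itv.
    move=> y [Iy]; rewrite /= !in_itv/= ge_max le_min => /andP[-> /ltW ->] /=.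
    by move: Iy; rewrite /I /= in_itv; case: (b1 k) (b2 k) => [] [] /= /andP[y1 y2];
      rewrite ?y1 ?y2 ?(ltW y1) ?(ltW y2).
  rewrite lebesgue_measure_itv_max lee_fin ge_max lexx /= subr_le0.
  rewrite le_max !ge_min; move/orP: (notin k _ Dx0) => n1; move/orP: (notin k _ Dx0T) => n2.
  move: Sk; rewrite /S => Sk.
  case: n1 => n1; last by rewrite n1 !orbT.
  case: n2 => n2; first by rewrite n2 !orbT.
  by exfalso; apply: Sk; rewrite n1.
(* If every finite part of the family had fewer than [L] intervals in the period, countable
   subadditivity would bound the measure by [(L - 1) delta]. *)
have [n nL] : exists n, (L <= size [seq k <- iota 0 n | S k])%N.
  apply: contrapT => H.
  suff : ((L%:R * delta)%:E <= ((L%:R - 1) * delta)%:E)%E by rewrite lee_fin; nra.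
  rewrite -(muD x0).
  apply: (@le_trans _ _ (\sum_(0 <= k <oo) mu (I k `&` `[x0, (x0 + T)%R[%classic))%E).
    apply: measure_sigma_subadditive.
    - by move=> k; apply: measurableI; exact: measurable_itv.
    - by apply: measurableI => //.
    - by rewrite DE => y [[k _ Iky] yx]; exists k.
  apply: lime_le; first by apply: is_cvg_nneseries => *; exact: measure_ge0.
  apply: nearW => n.
  apply: (@le_trans _ _ (\sum_(0 <= k < n) (if S k then delta else 0)%:E)%E).
    by apply: lee_sum => k _; exact: muI.
  rewrite sumEFin lee_fin -big_mkcond/= -big_filter big_const_seq count_predT.
  rewrite iter_addr_0 -[leLHS]mulr_natl ler_pM2r// lerBrDr natr1 ler_nat.
  rewrite /index_iota subn0 ltnNge; apply/negP => h; apply: H; exists n; exact: h.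
exists x0, [seq a k | k <- iota 0 n & S k]; split.
- by rewrite size_map.
- move=> b /mapP[k]; rewrite mem_filter => /andP[/andP[S1 S2] _] ->; split => //.
  by rewrite DE => y ya; exists k => //; exact: subI.
- rewrite pairwise_map.
  apply: (@sub_pairwise _ ltn).
    move=> i j ij /=; apply: (interval_intersection_sep d0) => x y.
    by apply: sep => ijE; move: ij; rewrite ijE /= ltnn.
  rewrite -sorted_pairwise; last exact: ltn_trans.
  by apply: sorted_filter; [exact: ltn_trans|exact: iota_ltn_sorted].
Qed.
End LowerBound.

(** * Lower bound for the increment energy, integrated over one period *)

Section IntegratedLowerBound.
Context {R : realType}.
Local Notation mu := (@lebesgue_measure R).
Implicit Types (u : R -> R) (T Lambda delta d h b x : R).

Lemma measurable_overlap_sqr d h b :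
  measurable_fun [set: R] (fun x => ((overlap d h (x - b)) ^+ 2)%:E).
Proof.
apply/measurable_EFinP; apply: measurable_funX.
apply: (measurableT_comp (measurable_overlap d h)).
exact: (measurable_addr (- b)).
Qed.

(** The overlap with the interval at [b] is supported in [[b - h, b + d]], which may stick out of
    the period to the left of [x0]. The copy at [b + T] supplies the missing part: shifted back, the
    two integrals together run over [[x0 - T, x0 + T[], which contains [[b - h, b + d[] since
    [h <= T]. *)
Lemma integral_overlap_sqr_translates d h b T x0 : 0 < d -> 0 < h -> h <= T ->
  x0 <= b -> b + d <= x0 + T ->
  ((overlap_energy d h)%:E <= \int[mu]_(x in `[x0, (x0 + T)%R[)
     ((overlap d h (x - b)) ^+ 2 + (overlap d h (x - (b + T))) ^+ 2)%:E)%E.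
Proof.
move=> d0 h0 hT x0b bT.
pose f x := ((overlap d h (x - b)) ^+ 2)%:E.
have mf : measurable_fun [set: R] f by exact: measurable_overlap_sqr.
have f0 x : (0 <= f x)%E by rewrite lee_fin sqr_ge0.
under eq_integral do rewrite EFinD.
rewrite ge0_integralD//; last 4 first.
- by move=> x _; rewrite lee_fin sqr_ge0.
- exact: measurable_funTS.
- by move=> x _; rewrite lee_fin sqr_ge0.
- by apply: measurable_funTS; exact: measurable_overlap_sqr.
have -> : (\int[mu]_(x in `[x0, (x0 + T)%R[) ((overlap d h (x - (b + T))) ^+ 2)%:E =
   \int[mu]_(x in `[(x0 - T)%R, x0[) f x)%E.
  have := @ge0_integral_itv_addr _ (- T) x0 (x0 + T) true true f mf f0.
  rewrite addrK => <-.
  by apply: eq_integral => x _; rewrite /f opprD addrA addrAC.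
rewrite addeC -(@ge0_integral_co_split _ (x0 - T) x0)//; [|lra|lra].
apply: (@le_trans _ _ (\int[mu]_(x in `[(b - h)%R, (b + d)%R[) f x)%E); last first.
  apply: ge0_subset_integral => //; first exact: measurable_funTS.
  by move=> x; rewrite /= !in_itv/= => /andP[x1 x2]; apply/andP; split; lra.
rewrite -integral_overlap_sqr//.
have -> : `[(b - h)%R, (b + d)%R[%classic = `[(- h + b)%R, (d + b)%R[%classic :> set R.
  by rewrite [- h + b]addrC [d + b]addrC.
rewrite -(@ge0_integral_itv_addr _ b (- h) d true true f)//.
by under [leRHS]eq_integral do rewrite /f addrK.
Qed.

Lemma increment_energy_lower (L : nat) delta u h : 0 < delta -> (0 < L)%N ->
  admissible (L%:R * (delta^-1 + 1) * delta) delta^-1 delta u -> 0 < h -> h <= 1 ->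
  ((L%:R * ((1 + delta^-1) ^+ 2 * overlap_energy delta h))%:E <=
   increment_energy (L%:R * (delta^-1 + 1) * delta) u h +
   (L%:R * (delta^-1 + 1) * delta * h ^+ 2)%:E)%E.
Proof.
move=> d0 L0 adm h0 h1.
have [x0 [bs [Lbs bsP sep]]] := admissible_periodic_intervals d0 L0 adm.
move: (adm) bsP; set T := L%:R * _ * delta => adm'.
have TE : T = L%:R * (1 + delta) by rewrite /T; field; rewrite gt_eqF.
have L1 : (1 : R) <= L%:R by rewrite ler1n.
have Ld0 : 0 <= L%:R * delta by rewrite mulr_ge0// ltW.
have T0 : 0 < T by rewrite TE; lra.
have hT : h <= T by rewrite TE; lra.
have V0 : 0 < delta^-1 by rewrite invr_gt0.
move=> bsP; have mD := admissible_measurable adm'.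
have incr := admissible_increment V0 adm'.
case: (adm') => cu uT _ _ _.
rewrite -integral_sqr_subincrement//.
pose P x := h - (u (x + h) - u x).
have mP : measurable_fun [set: R] (fun x => ((P x) ^+ 2)%:E).
  have mu' : measurable_fun [set: R] u by exact: continuous_measurable_fun.
  apply/measurable_EFinP; apply: measurable_funX; apply: measurable_funB => //.
  apply: measurable_funB => //.
  by apply: (measurableT_comp mu'); exact: measurable_addr.
rewrite -[leRHS](@ge0_integral_periodic _ T x0 (fun x => ((P x) ^+ 2)%:E))//; last 2 first.
- by move=> x; rewrite lee_fin sqr_ge0.
- by move=> x; rewrite /P addrAC !uT.
pose c := 1 + delta^-1.
have c0 : 0 < c by rewrite /c; lra.
(* A window starting in [[x0, x0 + T[] may run past [x0 + T], so the intervals of the next period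
   are included. They are descending by periodicity, and separated from those of [bs] because the
   latter all lie in [[x0, x0 + T]]. *)
pose bs2 := bs ++ [seq b + T | b <- bs].
have lowP x : c ^+ 2 * (\sum_(b <- bs) ((overlap delta h (x - b)) ^+ 2 +
    (overlap delta h (x - (b + T))) ^+ 2)) <= (P x) ^+ 2.
  have step : c * (\sum_(b <- bs2) overlap delta h (x - b)) <= P x.
    have -> : P x = (x + h - u (x + h)) - (x - u x) by rewrite /P; ring.
    rewrite -lee_fin incr; last lra.
    rewrite EFinM lee_pmul2l ?lte_fin//.
    apply: sum_overlap_le_measure => //.
      move=> b; rewrite mem_cat => /orP[/bsP[]//|/mapP[b' /bsP[_ _ bD] ->]].
      move=> y yb; have -> : y = y - T + T by rewrite subrK.
      rewrite neg_slope_set_periodic//; apply: bD; move: yb.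
      by rewrite /= !in_itv/= => /andP[y1 y2]; apply/andP; split; lra.
    rewrite pairwise_cat sep pairwise_map; apply/and3P; split => //.
      apply/allrelP => b b' /bsP[b1 b2 _] /mapP[b'' /bsP[b3 b4 _] ->].
      by apply/orP; left; lra.
    apply: sub_pairwise sep => b b' /= /orP[H|H]; apply/orP; [left|right]; lra.
  rewrite big_split/=.
  have -> : \sum_(b <- bs) overlap delta h (x - b) ^+ 2 +
      \sum_(b <- bs) overlap delta h (x - (b + T)) ^+ 2 =
      \sum_(b <- bs2) overlap delta h (x - b) ^+ 2 by rewrite big_cat big_map.
  apply: (@le_trans _ _ ((c * (\sum_(b <- bs2) overlap delta h (x - b))) ^+ 2)).
    rewrite exprMn ler_pM2l ?exprn_gt0//.
    by apply: sum_sqr_le_sqr_sum => b; exact: overlap_ge0.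
  have S0 : 0 <= \sum_(b <- bs2) overlap delta h (x - b).
    by apply: sumr_ge0 => b _; exact: overlap_ge0.
  rewrite lerXn2r// nnegrE; first by rewrite mulr_ge0// ltW.
  by rewrite (le_trans _ step)// mulr_ge0// ltW.
pose g b x := ((overlap delta h (x - b)) ^+ 2 + (overlap delta h (x - (b + T))) ^+ 2)%:E.
have mg b : measurable_fun [set: R] (g b).
  by apply/measurable_EFinP; apply: measurable_funD; apply/measurable_EFinP;
    exact: measurable_overlap_sqr.
have g0 b x : (0 <= g b x)%E by rewrite lee_fin addr_ge0// sqr_ge0.
apply: (@le_trans _ _ (\int[mu]_(x in `[x0, (x0 + T)%R[) ((c ^+ 2)%:E * \sum_(b <- bs) g b x))%E); last first.
  apply: ge0_le_integral => //.
  - by move=> x _; rewrite mule_ge0 ?sume_ge0// lee_fin sqr_ge0.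
  - apply: measurable_funTS; apply: emeasurable_funM => //.
    by apply: emeasurable_sum.
  - exact: measurable_funTS.
  - by move=> x _; rewrite sumEFin -EFinM lee_fin; exact: lowP.
rewrite ge0_integralZl_EFin ?sqr_ge0//; last 2 first.
- by move=> x _; rewrite sume_ge0.
- by apply: measurable_funTS; exact: emeasurable_sum.
rewrite ge0_integral_sum; [|exact: measurable_itv|by move=> b; apply: measurable_funTS; exact: mg|by move=> b x _].
have -> : L%:R * (c ^+ 2 * overlap_energy delta h) = c ^+ 2 * (L%:R * overlap_energy delta h).
  by rewrite mulrCA.
rewrite EFinM lee_pmul2l ?lte_fin ?exprn_gt0//.
have E0 : 0 <= overlap_energy delta h by apply: overlap_energy_ge0; exact: ltW.
apply: (@le_trans _ _ (\sum_(b <- bs) (overlap_energy delta h)%:E)%E).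
  rewrite sumEFin lee_fin big_const_seq count_predT iter_addr_0 -[leRHS]mulr_natl.
  by rewrite ler_wpM2r// ler_nat.
rewrite !big_seq; apply: lee_sum => b /bsP[b1 b2 _].
exact: integral_overlap_sqr_translates.
Qed.
End IntegratedLowerBound.

(** * The sawtooth *)

Section Sawtooth.
Context {R : realType}.
Local Notation mu := (@lebesgue_measure R).

Section PiecewiseAffine.
Variable u : R -> R.

Definition affine_pieces (a b : R) := exists (m : nat) (t : nat -> R),
  [/\ t 0%N = a, t m = b,
      (forall i, (i < m)%N -> t i < t i.+1) &
      (forall i, (i < m)%N -> exists alpha beta : R,
          forall x, t i <= x <= t i.+1 -> u x = alpha * x + beta)].

Lemma affine_pieces_snoc (a b c al be : R) : affine_pieces a b -> b < c ->
  (forall x, b <= x <= c -> u x = al * x + be) -> affine_pieces a c.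
Proof.
move=> [m [t [ta tb tlt tu]]] bc ub.
exists m.+1, (fun i => if (i <= m)%N then t i else c); split => //=.
- by rewrite ltnn.
- move=> i; rewrite ltnS => im; rewrite im; case: ifP => im1; first exact: tlt.
  have -> : i = m by apply/eqP; rewrite eqn_leq im leqNgt im1.
  by rewrite tb.
- move=> i; rewrite ltnS => im; rewrite im; case: ifP => im1; first exact: tu.
  have -> : i = m by apply/eqP; rewrite eqn_leq im leqNgt im1.
  by exists al, be => x; rewrite tb; exact: ub.
Qed.

(** The last piece [[t n, b]] is appended to a subdivision of [[a, t n]], or covers [[a, b]] alone
    when [a] is already beyond [t n]. *)
Lemma affine_pieces_breakpoints (t : nat -> R) (n : nat) :
  (forall i, t i < t i.+1) ->
  (forall i, exists alpha beta : R,
    forall x, t i <= x <= t i.+1 -> u x = alpha * x + beta) ->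
  forall a b, t 0%N <= a -> a < b -> b <= t n -> affine_pieces a b.
Proof.
move=> tlt tu; elim: n => [|n IH] a b ta ab btn; first by lra.
have [bn|nb] := leP b (t n); first exact: IH.
have [al [be ub]] := tu n.
have [na|an] := leP (t n) a.
  exists 1%N, (fun i => if i is 0%N then a else b); split => // -[|//] _ //=.
  by exists al, be => x /andP[ax xb]; apply: ub; apply/andP; split; lra.
apply: (affine_pieces_snoc (IH _ _ ta an (lexx _)) nb (al := al) (be := be)).
by move=> x /andP[ax xb]; apply: ub; apply/andP; split; lra.
Qed.
End PiecewiseAffine.

Variable d : R.
Hypothesis d0 : 0 < d.

(** In the cell coordinate [t] the lines of slopes [- 1/d] and [1] meet at [t = d] with value [0],
    and the maximum selects the first before [d] and the second after. The cell has length [1 + d]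
    because the drop of [1] over length [d] is regained by ascending over length [1]. *)
Definition sawtooth (x : R) : R :=
  let t := x - (Num.floor (x / (1 + d)))%:~R * (1 + d) in Num.max (1 - t / d) (t - d).

Let p0 : 0 < 1 + d. Proof. by rewrite addr_gt0. Qed.

(** The right end is included although the floor jumps there: both adjacent cells give the peak
    value [1]. Closed cells are what [piecewise_affine] requires. *)
Lemma sawtooth_cell (k : int) (x : R) : k%:~R * (1 + d) <= x <= k%:~R * (1 + d) + (1 + d) ->
  sawtooth x = Num.max (1 - (x - k%:~R * (1 + d)) / d) (x - k%:~R * (1 + d) - d).
Proof.
have dp := d0; have pp := p0.
move=> /andP[kx]; rewrite le_eqVlt => /predU1P[->|xk].
  have -> : sawtooth (k%:~R * (1 + d) + (1 + d)) = 1.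
    have -> : k%:~R * (1 + d) + (1 + d) = (k + 1)%:~R * (1 + d).
      by rewrite intrD [RHS]mulrDl mul1r.
    rewrite /sawtooth mulfK ?gt_eqF// intrKfloor subrr mul0r subr0 sub0r.
    by rewrite (max_idPl _)//; lra.
  have -> : k%:~R * (1 + d) + (1 + d) - k%:~R * (1 + d) = 1 + d by rewrite addrC addKr.
  have -> : (1 + d) / d = 1 + d^-1 by field; rewrite gt_eqF.
  have V0 : 0 < d^-1 by rewrite invr_gt0.
  by rewrite (max_idPr _); lra.
rewrite /sawtooth; have -> // : Num.floor (x / (1 + d)) = k.
apply: floor_def; rewrite ler_pdivlMr// kx intrD ltr_pdivrMr//= mulrDl; lra.
Qed.

Lemma sawtooth_desc (k : int) (x : R) : k%:~R * (1 + d) <= x <= k%:~R * (1 + d) + d ->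
  sawtooth x = - d^-1 * x + (1 + k%:~R * (1 + d) / d).
Proof.
have dp := d0; have pp := p0.
move=> /andP[kx xk]; rewrite (@sawtooth_cell k); last by apply/andP; split; lra.
have td : (x - k%:~R * (1 + d)) / d <= 1 by rewrite ler_pdivrMr//; lra.
rewrite (max_idPl _); first by ring.
lra.
Qed.

Lemma sawtooth_asc (k : int) (x : R) : k%:~R * (1 + d) + d <= x <= k%:~R * (1 + d) + (1 + d) ->
  sawtooth x = 1 * x + (- (k%:~R * (1 + d)) - d).
Proof.
have dp := d0; have pp := p0.
move=> /andP[kx xk]; rewrite (@sawtooth_cell k); last by apply/andP; split; lra.
have td : 1 <= (x - k%:~R * (1 + d)) / d by rewrite ler_pdivlMr//; lra.
rewrite (max_idPr _); first by ring.
lra.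
Qed.

Lemma sawtooth_floor (x : R) : exists k : int, k%:~R * (1 + d) <= x < k%:~R * (1 + d) + (1 + d).
Proof.
have dp := d0; have pp := p0.
exists (Num.floor (x / (1 + d))).
rewrite -ler_pdivlMr// floor_le/=.
by have := floorD1_gt (x / (1 + d)); rewrite intrD ltr_pdivrMr// mulrDl mul1r.
Qed.

Lemma sawtooth_periodic (x : R) : sawtooth (x + (1 + d)) = sawtooth x.
Proof.
have dp := d0; have pp := p0.
have [k /andP[kx xk]] := sawtooth_floor x.
rewrite (@sawtooth_cell k x); last by rewrite kx ltW.
rewrite (@sawtooth_cell (k + 1)); last by rewrite intrD; apply/andP; split; lra.
by rewrite intrD; congr (Num.max (1 - _ / _) (_ - _)); ring.
Qed.

Lemma sawtooth_itv01 (x : R) : 0 <= sawtooth x <= 1.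
Proof.
have dp := d0; have pp := p0.
have [k /andP[kx xk]] := sawtooth_floor x.
rewrite (@sawtooth_cell k x); last by rewrite kx ltW.
have t0 : 0 <= (x - k%:~R * (1 + d)) / d by rewrite divr_ge0//; lra.
rewrite le_max ge_max; apply/andP; split; last by apply/andP; split; lra.
have [h|h] := leP (x - k%:~R * (1 + d)) d.
  apply/orP; left; rewrite subr_ge0 ler_pdivrMr//; lra.
by apply/orP; right; lra.
Qed.

Lemma sawtooth_continuous : continuous sawtooth.
Proof.
have dp := d0; have pp := p0.
move=> x; have [k /andP[]] := sawtooth_floor x; rewrite le_eqVlt => /predU1P[kx|kx] xk.
  (* At a peak two cells meet, and locally the sawtooth is the minimum of the ascending line on the
     left and the descending line on the right. *)
  pose g y := Num.min (y - x + 1) (1 - (y - x) / d).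
  have cg : {for x, continuous g}.
    apply: continuous_min.
      by apply: continuousD; [apply: continuousB => //; exact: cst_continuous|exact: cst_continuous].
    apply: continuousB; first exact: cst_continuous.
    by apply: continuousM; [apply: continuousB => //; exact: cst_continuous|exact: cst_continuous].
  have ng : {near x, g =1 sawtooth}.
    near=> y; have [xy|yx] := leP x y.
      rewrite (@sawtooth_desc k); last first.
        rewrite kx xy/=; apply: ltW; near: y; apply: lt_nbhsl; lra.
      have h : 0 <= (y - x) / d by rewrite divr_ge0//; lra.
      by rewrite /g (min_idPr _); [rewrite kx; ring|lra].
    rewrite (@sawtooth_asc (k - 1)); last first.
      rewrite intrB; apply/andP; split; last by lra.
      apply: ltW; near: y; apply: lt_nbhsr; lra.
    have h : (y - x) / d <= 0 by rewrite ler_pdivrMr// mul0r; lra.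
    by rewrite /g (min_idPl _); [rewrite intrB -kx; ring|lra].
  rewrite /continuous_at -(nbhs_singleton ng).
  exact: (cvg_trans (near_eq_cvg ng)).
pose g y := Num.max (1 - (y - k%:~R * (1 + d)) / d) (y - k%:~R * (1 + d) - d).
have cg : {for x, continuous g}.
  apply: continuous_max.
    apply: continuousB; first exact: cst_continuous.
    by apply: continuousM; [apply: continuousB => //; exact: cst_continuous|exact: cst_continuous].
  by apply: continuousB; [apply: continuousB => //; exact: cst_continuous|exact: cst_continuous].
have ng : {near x, g =1 sawtooth}.
  near=> y; rewrite (@sawtooth_cell k)//; apply/andP; split; apply: ltW; near: y.
    exact: lt_nbhsr.
  exact: lt_nbhsl.
rewrite /continuous_at -(nbhs_singleton ng).
exact: (cvg_trans (near_eq_cvg ng)).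
Unshelve. all: by end_near. Qed.

Lemma sawtooth_piecewise_affine : piecewise_affine sawtooth.
Proof.
have dp := d0; have pp := p0.
move=> a b ab; have [k /andP[ka ak]] := sawtooth_floor a.
(* Even indices are peaks, odd indices are valleys. *)
pose t (i : nat) := k%:~R * (1 + d) + i./2%:R * (1 + d) + (if odd i then d else 0).
have tE j : t j.*2 = k%:~R * (1 + d) + j%:R * (1 + d).
  by rewrite /t odd_double doubleK addr0.
have tO j : t j.*2.+1 = k%:~R * (1 + d) + j%:R * (1 + d) + d.
  by rewrite /t /= odd_double uphalf_double.
have kj (j : nat) : (k + j%:Z)%:~R * (1 + d) = k%:~R * (1 + d) + j%:R * (1 + d).
  by rewrite intrD mulrDl.
have [n bn] : exists n, b <= t n.
  exists (Num.trunc ((b - k%:~R * (1 + d)) / (1 + d))).+1.*2.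
  rewrite /t odd_double addr0 doubleK -lerBlDl -ler_pdivrMr//.
  by apply: ltW; exact: truncnS_gt.
apply: (@affine_pieces_breakpoints _ t n) => //; last by rewrite /t /= mul0r !addr0.
- move=> i; case: (odd i) (odd_double_half i) => /= <-; set j := i./2.
    by rewrite add1n -doubleS tO tE -natr1; lra.
  by rewrite add0n tO tE; lra.
- move=> i; case: (odd i) (odd_double_half i) => /= <-; set j := i./2.
    rewrite add1n -doubleS tO tE -natr1 -kj.
    exists 1, (- ((k + j%:Z)%:~R * (1 + d)) - d) => x /andP[x1 x2].
    apply: sawtooth_asc; rewrite x1/=; move: (kj j) x1 x2; lra.
  rewrite add0n tO tE -kj.
  exists (- d^-1), (1 + (k + j%:Z)%:~R * (1 + d) / d) => x; exact: sawtooth_desc.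
Qed.

Lemma sawtooth_derive_desc (k : int) (x : R) :
  k%:~R * (1 + d) < x < k%:~R * (1 + d) + d -> is_derive x 1 sawtooth (- d^-1).
Proof. by move=> xk; apply: (affine_derive _ xk) => y; exact: sawtooth_desc. Qed.

Lemma sawtooth_derive_asc (k : int) (x : R) :
  k%:~R * (1 + d) + d < x < k%:~R * (1 + d) + (1 + d) -> is_derive x 1 sawtooth 1.
Proof. by move=> xk; apply: (affine_derive _ xk) => y; exact: sawtooth_asc. Qed.

Lemma sawtooth_ae_slope : {ae mu, forall x,
  derivable sawtooth x 1 /\ (derive1 sawtooth x = 1 \/ derive1 sawtooth x = - d^-1)}.
Proof.
pose B : set R := [set k%:~R * (1 + d) + (if e then d else 0) | k in [set: int] & e in [set: bool]].
have cB : countable B.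
  by apply: (@sub_countable _ _ _ [set: int * bool]) => //; rewrite /B image2E setXTT; exact: card_image_le.
apply: (@negligibleS _ _ _ mu B); last first.
  apply/negligibleP; last exact: countable_lebesgue_measure0.
  by apply: countable_measurable.
move=> x /= Px; apply: contrapT => Bx; apply: Px.
have [k /andP[]] := sawtooth_floor x; rewrite le_eqVlt => /predU1P[kx|kx] xk.
  by exfalso; apply: Bx; exists k => //; exists false => //; rewrite addr0.
have [xd|dx|xE] := ltgtP x (k%:~R * (1 + d) + d).
- have xI : k%:~R * (1 + d) < x < k%:~R * (1 + d) + d by rewrite kx.
  have [dv ev] := sawtooth_derive_desc xI.
  by split => //; right; rewrite derive1E.
- have xI : k%:~R * (1 + d) + d < x < k%:~R * (1 + d) + (1 + d) by rewrite dx.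
  have [dv ev] := sawtooth_derive_asc xI.
  by split => //; left; rewrite derive1E.
- by exfalso; apply: Bx; exists k => //; exists true.
Qed.

Let V0 : 0 < d^-1. Proof. by rewrite invr_gt0. Qed.

Lemma sawtooth_neg_slope_desc (k : int) (x : R) :
  k%:~R * (1 + d) < x < k%:~R * (1 + d) + d -> neg_slope_set sawtooth d^-1 x.
Proof. by move=> /sawtooth_derive_desc[? ?]; split => //; rewrite derive1E. Qed.

Lemma sawtooth_neg_slope_asc (k : int) (x : R) :
  k%:~R * (1 + d) + d < x < k%:~R * (1 + d) + (1 + d) -> ~ neg_slope_set sawtooth d^-1 x.
Proof.
move=> /sawtooth_derive_asc[_ e] [_]; rewrite derive1E e => e1.
by have := V0; lra.
Qed.

Lemma sawtooth_admissible (L : nat) : admissible (L%:R * (d^-1 + 1) * d) d^-1 d sawtooth.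
Proof.
split.
- exact: sawtooth_continuous.
- move=> x; have -> : L%:R * (d^-1 + 1) * d = (Posz L)%:~R * (1 + d).
    by rewrite -pmulrn; field; rewrite gt_eqF.
  exact/periodic_int/sawtooth_periodic.
- exact: sawtooth_piecewise_affine.
- exact: sawtooth_ae_slope.
(* An enumeration of the integers by [nat], since [admissible] indexes its intervals by [nat]. *)
pose z (n : nat) : int := if odd n then Negz n./2 else Posz n./2.
have zK (k : int) : exists n, z n = k.
  case: k => m; [exists m.*2|exists m.*2.+1]; rewrite /z /= odd_double ?doubleK//.
  by rewrite uphalf_double.
have z_inj i j : z i = z j -> i = j.
  rewrite /z => e; rewrite -(odd_double_half i) -(odd_double_half j).
  by move: e; case: (odd i); case: (odd j) => // -[->].
pose a n := (z n)%:~R * (1 + d).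
(* Excluded middle decides which endpoints to include, so the corners need no separate
   discussion of derivability. *)
exists a, (fun n => `[< neg_slope_set sawtooth d^-1 (a n) >]),
  (fun n => ~~ `[< neg_slope_set sawtooth d^-1 (a n + d) >]) => /=; split.
  apply/seteqP; split => [x Dx|x [n _]].
    have [k /andP[kx xk]] := sawtooth_floor x.
    have [n nk] := zK k; exists n => //=; rewrite in_itv /a nk.
    apply/andP; split.
      move: kx; rewrite le_eqVlt => /predU1P[->|kx]; last by case: asboolP => _ /=; rewrite ?kx ?(ltW kx).
      by rewrite (asboolT Dx) /= lexx.
    have [xd|dx|xE] := ltgtP x (k%:~R * (1 + d) + d).
    + by case: asboolP => _ /=; rewrite ?xd ?(ltW xd).
    + by exfalso; apply: (@sawtooth_neg_slope_asc k x) => //; rewrite dx.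
    + by rewrite -xE (asboolT Dx) /= lexx.
  rewrite /= in_itv => /andP[].
  case: asboolP => [D1|_] /=.
    rewrite le_eqVlt => /predU1P[<-//|ax].
    case: asboolP => [D2|_] /=.
      rewrite le_eqVlt => /predU1P[->//|xa].
      by apply: (@sawtooth_neg_slope_desc (z n)); rewrite ax.
    by move=> xa; apply: (@sawtooth_neg_slope_desc (z n)); rewrite ax.
  move=> ax; case: asboolP => [D2|_] /=.
    rewrite le_eqVlt => /predU1P[->//|xa].
    by apply: (@sawtooth_neg_slope_desc (z n)); rewrite ax.
  by move=> xa; apply: (@sawtooth_neg_slope_desc (z n)); rewrite ax.
have bnd (e1 e2 : bool) (c x : R) : x \in Interval (BSide e1 c) (BSide e2 (c + d)) -> c <= x <= c + d.
  by rewrite in_itv; case: e1 e2 => [] [] /= /andP[h1 h2]; rewrite ?h1 ?h2 ?(ltW h1) ?(ltW h2).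
(* Distinct intervals are at distance at least [1], so they share no point, whichever endpoints were
   included. *)
move=> i j ij x y /bnd/andP[x1 x2] /bnd/andP[x3 x4] _ _; exfalso.
have step m n : (z m < z n)%R -> a m + (1 + d) <= a n.
  move=> mn; rewrite /a -{2}[1 + d]mul1r -mulrDl ler_pM2r//.
  by rewrite -[1]/(1%:~R) -intrD ler_int lezD1.
have [zij|zji|/z_inj//] := ltgtP (z i) (z j).
  by have := step _ _ zij; have dp := d0; lra.
by have := step _ _ zji; have dp := d0; lra.
Qed.

(** A window of length [h <= 1] starting in []-1, d[] stays inside []-1, 1 + d[], where the
    descending set is contained in [[0, d]]. A single overlap then controls the increment of
    [x - u x]. *)
Lemma increment_energy_sawtooth (L : nat) (h : R) : (0 < L)%N -> 0 < h -> h <= 1 ->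
  (increment_energy (L%:R * (d^-1 + 1) * d) sawtooth h +
   (L%:R * (d^-1 + 1) * d * h ^+ 2)%:E <=
   (L%:R * ((1 + d^-1) ^+ 2 * overlap_energy d h))%:E)%E.
Proof.
move=> L0 h0 h1; have dp := d0; have pp := p0.
have adm := sawtooth_admissible L.
have L1 : (1 : R) <= L%:R by rewrite ler1n.
have TE : L%:R * (d^-1 + 1) * d = L%:R * (1 + d) by field; rewrite gt_eqF.
have T0 : 0 < L%:R * (1 + d) by rewrite mulr_gt0//; lra.
have mD := admissible_measurable adm.
have incr := admissible_increment V0 adm.
case: (adm) => cu uT _ _ _.
rewrite TE in uT *.
rewrite -integral_sqr_subincrement//.
pose P x := h - (sawtooth (x + h) - sawtooth x).
have mP : measurable_fun [set: R] (fun x => ((P x) ^+ 2)%:E).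
  have mu' : measurable_fun [set: R] sawtooth by exact: continuous_measurable_fun.
  apply/measurable_EFinP; apply: measurable_funX; apply: measurable_funB => //.
  apply: measurable_funB => //.
  by apply: (measurableT_comp mu'); exact: measurable_addr.
have P0 x : (0 <= ((P x) ^+ 2)%:E)%E by rewrite lee_fin sqr_ge0.
have PP x : ((P (x + (1 + d))) ^+ 2)%:E = ((P x) ^+ 2)%:E.
  by rewrite /P addrAC !sawtooth_periodic.
rewrite (@ge0_integral_periods _ (1 + d) L (fun x => ((P x) ^+ 2)%:E))//.
rewrite EFinM lee_pmul2l ?lte_fin//; last by lra.
(* The period is moved to [[-1, d[] to surround the descending interval at [0]; its left end, a
   corner of the sawtooth, is then discarded as a null set. *)
rewrite -(@ge0_integral_periodic _ (1 + d) (- 1))// addKr.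
rewrite -integral_itv_obnd_cbnd; last exact: measurable_funTS.
pose c := 1 + d^-1.
have c0 : 0 < c by have := V0; rewrite /c; lra.
pose f x := ((overlap d h x) ^+ 2)%:E.
have mf : measurable_fun [set: R] f.
  by apply/measurable_EFinP; apply: measurable_funX; exact: measurable_overlap.
have f0 x : (0 <= f x)%E by rewrite lee_fin sqr_ge0.
apply: (@le_trans _ _ (\int[mu]_(x in `](- 1)%R, d[) ((c ^+ 2)%:E * f x))%E).
  apply: ge0_le_integral => //.
  - exact: measurable_funTS.
  - by apply: measurable_funTS; apply: emeasurable_funM.
  move=> x; rewrite /= in_itv/= => /andP[x1 xd]; rewrite -EFinM lee_fin -exprMn.
  have PE : P x = (x + h - sawtooth (x + h)) - (x - sawtooth x) by rewrite /P; ring.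
  have Pge0 : 0 <= P x.
    rewrite PE -lee_fin incr; last lra.
    by rewrite mule_ge0// lee_fin ltW.
  rewrite lerXn2r// ?nnegrE ?mulr_ge0 ?overlap_ge0 ?(ltW c0)//.
  rewrite PE -lee_fin incr; last lra.
  rewrite EFinM lee_pmul2l ?lte_fin// -[x in overlap _ _ x](subr0 x).
  apply: measure_le_overlap => // y [Dy]; rewrite /= !in_itv/= => /andP[xy yx].
  rewrite add0r; apply/andP; split; rewrite leNgt; apply/negP => H.
    apply: (@sawtooth_neg_slope_asc (- 1) y) => //.
    by rewrite mulrNz mulr1z mulN1r; apply/andP; split; lra.
  apply: (@sawtooth_neg_slope_asc 0 y) => //.
  by rewrite mulr0z mul0r; apply/andP; split; lra.
rewrite ge0_integralZl_EFin ?sqr_ge0//; last exact: measurable_funTS.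
rewrite [leRHS]EFinM lee_pmul2l ?lte_fin ?exprn_gt0//.
rewrite integral_itv_obnd_cbnd; last exact: measurable_funTS.
rewrite (@ge0_integral_co_split _ (- 1) (- h))//; [|lra|lra].
rewrite integral_overlap_sqr// [X in (X + _)%E]integral0_eq ?add0e//.
move=> x; rewrite /= in_itv/= => /andP[_ xh].
by rewrite /f overlap_out ?expr0n//; left; exact: ltW.
Qed.
End Sawtooth.

(** * Energy bounds and asymptotics *)

Section EnergyBounds.
Context {R : realType}.
Local Notation mu := (@lebesgue_measure R).

Variables (s d : R) (L : nat).
Hypotheses (s2 : 2^-1 <= s) (s1 : s < 1) (d0 : 0 < d) (d1 : d < 1) (L0 : (0 < L)%N).
Let T := L%:R * (d^-1 + 1) * d.
Let w (h : R) := h `^ (- (1 + 2 * s)).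

Let TE : T = L%:R * (1 + d). Proof. by rewrite /T; field; rewrite gt_eqF. Qed.
Let T0 : 0 < T. Proof. by rewrite TE mulr_gt0 ?ltr0n// addr_gt0. Qed.
Let s0 : 0 < s. Proof. by rewrite (lt_le_trans _ s2)// invr_gt0. Qed.
Let w0 h : 0 <= w h. Proof. exact: powR_ge0. Qed.
Let mw : measurable_fun [set: R] w. Proof. exact: measurable_powR. Qed.

Lemma increment_energy_ge0 (u : R -> R) h : (0 <= increment_energy T u h)%E.
Proof. by apply: integral_ge0 => x _; rewrite lee_fin sqr_ge0. Qed.

Let energy (u : R -> R) h := ((w h)%:E * increment_energy T u h)%E.

Let energy_ge0 u h : (0 <= energy u h)%E.
Proof. by rewrite mule_ge0 ?lee_fin// increment_energy_ge0. Qed.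

Lemma FT_energy (u : R -> R) : continuous u -> (forall x, u (x + T) = u x) ->
  measurable_fun (`]0, +oo[%classic : set R) (energy u) /\
  FT T s u = ((T^-1)%:E * \int[mu]_(h in `]0%R, +oo[) energy u h)%E.
Proof.
move=> cu uT; have mu' : measurable_fun [set: R] u by exact: continuous_measurable_fun.
have [mE ->] := FT_increment_energy T0 s0 mu' uT.
have E h : (`]0, +oo[%classic : set R) h ->
    ((`|h| `^ (- (1 + 2 * s)))%:E * increment_energy T u h)%E = energy u h.
  by rewrite /= in_itv/= andbT => h0; rewrite /energy /w gtr0_norm.
split; last by under eq_integral => h /set_mem hI do rewrite (E h hI).
apply: (eq_measurable_fun _ _ (measurable_funTS mE)) => h /set_mem; exact: E.
Qed.

Let S01 : (`]0, 1]%classic : set R) `<=` `]0, +oo[%classic.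
Proof. by move=> x; rewrite /= !in_itv/= => /andP[->]. Qed.

(** The prefactor is [L (1 + 1/d)^2 d^2 = L (1 + d)^2 = T (1 + d)]: this is where the factor [1 + d]
    of both bounds comes from. *)
Let integral_overlap_scaled : (\int[mu]_(h in `]0%R, 1%R]) ((w h)%:E * (L%:R * ((1 + d^-1) ^+ 2 * overlap_energy d h))%:E) =
  (T * ((1 + d) * (sigma_scale s d + energy_correction s d)))%:E)%E.
Proof.
have c0 : 0 <= L%:R * (1 + d^-1) ^+ 2 by rewrite mulr_ge0 ?sqr_ge0.
transitivity (\int[mu]_(h in `]0%R, 1%R]) ((L%:R * (1 + d^-1) ^+ 2)%:E *
   (overlap_energy d h * h `^ (- (1 + 2 * s)))%:E))%E.
  by apply: eq_integral => h _; rewrite -!EFinM /w; congr (_%:E); ring.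
rewrite ge0_integralZl_EFin//; last 2 first.
- move=> h; rewrite /= in_itv/= => /andP[h0 _].
  by rewrite lee_fin mulr_ge0 ?powR_ge0// overlap_energy_ge0// ltW.
- apply: measurable_funTS; apply/measurable_EFinP; apply: measurable_funM => //.
  exact: measurable_overlap_energy.
rewrite integral_overlap_energy// -EFinM TE; congr (_%:E).
by field; rewrite gt_eqF.
Qed.

(** The energy of [h > 1] is discarded. The correction is moved to the energy side, so that all
    integrands are nonnegative and [increment_energy_lower] can be used pointwise under the
    kernel. *)
Lemma FT_lower (u : R -> R) : admissible T d^-1 d u ->
  (((1 + d) * (sigma_scale s d + energy_correction s d) - (2 - 2 * s)^-1)%:E <= FT T s u)%E.
Proof.
move=> adm; case: (adm) => cu uT _ _ _.
have [mE ->] := FT_energy cu uT.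
have mE1 : measurable_fun (`]0, 1]%classic : set R) (energy u) by apply: measurable_funS mE => //.
rewrite EFinB leeBlDr//.
have -> : ((1 + d) * (sigma_scale s d + energy_correction s d))%:E =
  ((T^-1)%:E * (T * ((1 + d) * (sigma_scale s d + energy_correction s d)))%:E)%E.
  by rewrite -EFinM mulKf// gt_eqF.
have -> : ((2 - 2 * s)^-1)%:E = ((T^-1)%:E * (T * (2 - 2 * s)^-1)%:E)%E.
  by rewrite -EFinM mulKf// gt_eqF.
rewrite -ge0_muleDr//; last 2 first.
- by apply: integral_ge0 => h _; exact: energy_ge0.
- by rewrite lee_fin mulr_ge0 ?(ltW T0)// invr_ge0; move: s1; lra.
rewrite lee_pmul2l ?lte_fin ?invr_gt0// -integral_overlap_scaled.
apply: (@le_trans _ _ (\int[mu]_(h in `]0%R, 1%R]) energy u h + (T * (2 - 2 * s)^-1)%:E)%E); last first.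
  by rewrite leeD2r//; apply: ge0_subset_integral => // h _; exact: energy_ge0.
rewrite [(T * (2 - 2 * s)^-1)%:E]EFinM -integral_sqr_powR//.
have mq : measurable_fun (`]0, 1]%classic : set R) (fun h : R => (h ^+ 2 * w h)%:E).
  by apply: measurable_funTS; apply/measurable_EFinP; apply: measurable_funM.
rewrite -ge0_integralZl_EFin ?(ltW T0)//; last first.
  by move=> h _; rewrite lee_fin; apply: mulr_ge0; [exact: sqr_ge0|exact: w0].
rewrite -ge0_integralD//; last 2 first.
- move=> h _; rewrite -EFinM lee_fin; apply: mulr_ge0; first exact: ltW.
  by apply: mulr_ge0; [exact: sqr_ge0|exact: w0].
- exact: emeasurable_funM.
apply: ge0_le_integral => //.
- move=> h; rewrite /= in_itv/= => /andP[h0 _].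
  rewrite -EFinM lee_fin; apply: mulr_ge0; first exact: w0.
  apply: mulr_ge0 => //.
  by apply: mulr_ge0; [exact: sqr_ge0|apply: overlap_energy_ge0; exact: ltW].
- apply: measurable_funTS; apply: emeasurable_funM; apply/measurable_EFinP => //.
  apply: measurable_funM => //; apply: measurable_funM => //.
  exact: measurable_overlap_energy.
- by apply: emeasurable_funD => //; exact: emeasurable_funM.
move=> h; rewrite /= in_itv/= => /andP[h0 h1].
have -> : (energy u h + T%:E * (h ^+ 2 * w h)%:E)%E =
   ((w h)%:E * (increment_energy T u h + (T * h ^+ 2)%:E))%E.
  have Th : 0 <= T * h ^+ 2 by exact: mulr_ge0 (ltW T0) (sqr_ge0 _).
  rewrite ge0_muleDr ?increment_energy_ge0 ?lee_fin//.
  by rewrite -!EFinM; congr (_ + _%:E)%E; ring.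
by apply: lee_wpmul2l; [rewrite lee_fin|exact: increment_energy_lower].
Qed.

(** For [h <= 1] the sawtooth estimate is used with [T h^2] dropped. For [h > 1] the values in
    [[0, 1]] bound the increment energy by [T], and [integral_powR_tail] turns this into the
    additive [1]. *)
Lemma FT_sawtooth_upper :
  (FT T s (sawtooth d) <= ((1 + d) * (sigma_scale s d + energy_correction s d) + 1)%:E)%E.
Proof.
have adm := sawtooth_admissible d0 L; case: (adm) => cu uT _ _ _.
have [mE ->] := FT_energy cu uT.
have mE1 : measurable_fun (`]0, 1]%classic : set R) (energy (sawtooth d)) by apply: measurable_funS mE => //.
have S1 : (`]1, +oo[%classic : set R) `<=` `]0, +oo[%classic.
  by move=> x; rewrite /= !in_itv/= !andbT; apply: lt_trans.
have mE2 : measurable_fun (`]1, +oo[%classic : set R) (energy (sawtooth d)) by apply: measurable_funS mE => //.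
have -> : ((1 + d) * (sigma_scale s d + energy_correction s d) + 1)%:E =
  ((T^-1)%:E * ((T * ((1 + d) * (sigma_scale s d + energy_correction s d)))%:E + T%:E))%E.
  by rewrite -EFinD -EFinM; congr (_%:E); rewrite [RHS]mulrDr mulKf ?mulVf// gt_eqF.
rewrite lee_pmul2l ?lte_fin ?invr_gt0//.
have U : `]0, +oo[%classic = `]0, 1]%classic `|` `]1, +oo[%classic :> set R.
  apply/seteqP; split => x /=; rewrite !in_itv/= !andbT.
    by move=> x0; case: (leP x 1) => x1; [left|right]; rewrite ?x0.
  by move=> [/andP[]//|]; exact: lt_trans.
rewrite U ge0_integral_setU//; last 2 first.
- by rewrite -U.
- by apply/disj_setPS => x /=; rewrite !in_itv/= andbT => -[/andP[_ x1] /(le_lt_trans x1)]; rewrite ltxx.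
apply: leeD.
  rewrite -integral_overlap_scaled; apply: ge0_le_integral => //.
  - apply: measurable_funTS; apply: emeasurable_funM; apply/measurable_EFinP => //.
    apply: measurable_funM => //; apply: measurable_funM => //.
    exact: measurable_overlap_energy.
  move=> h; rewrite /= in_itv/= => /andP[h0 h1].
  apply: lee_wpmul2l; first by rewrite lee_fin.
  apply: le_trans (increment_energy_sawtooth d0 L0 h0 h1).
  by rewrite leeDl// lee_fin; exact: mulr_ge0 (ltW T0) (sqr_ge0 _).
apply: (@le_trans _ _ (\int[mu]_(h in `]1%R, +oo[) (T%:E * (w h)%:E))%E).
  apply: ge0_le_integral => //.
  - by apply: measurable_funTS; apply: emeasurable_funM => //; apply/measurable_EFinP.
  move=> h _; rewrite [leRHS]muleC; apply: lee_wpmul2l; first by rewrite lee_fin; exact: w0.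
  have -> : T%:E = (\int[mu]_(x in `[0%R, T[) 1%:E)%E.
    by rewrite integral_cst_co ?(ltW T0)// subr0 mul1r.
  apply: ge0_le_integral => //.
  - by move=> x _; rewrite lee_fin sqr_ge0.
  - apply: measurable_funTS; apply: measurable_increment.
    exact: continuous_measurable_fun.
  move=> x _; rewrite lee_fin.
  have /andP[a1 a2] := sawtooth_itv01 d0 x.
  have /andP[a3 a4] := sawtooth_itv01 d0 (x + h).
  nra.
rewrite ge0_integralZl_EFin ?(ltW T0)//; last 2 first.
- by move=> h _; rewrite lee_fin.
- by apply: measurable_funTS; apply/measurable_EFinP.
rewrite -[leRHS]mule1; apply: lee_wpmul2l; first by rewrite lee_fin ltW.
exact: integral_powR_tail.
Qed.
End EnergyBounds.

(** * Divergence of the scale and passage to the limit *)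

Section Asymptotics.
Context {R : realType}.

Lemma sigma_scale_gt0 (s x : R) : 2^-1 <= s -> s < 1 -> 0 < x -> x < 1 -> 0 < sigma_scale s x.
Proof.
move=> s2 s1 x0 x1; rewrite /sigma_scale; case: eqVneq => sE.
  by rewrite ln_gt0// invf_gt1.
have s3 : 2^-1 < s by rewrite lt_neqAle eq_sym sE.
by rewrite divr_gt0 ?powR_gt0// !mulr_gt0//; lra.
Qed.

(** The divergence of the scale is stated through its reciprocal, the factor that multiplies the
    bounded errors. For [s > 1/2] the reciprocal is a constant times [x^(2s - 1)]. *)
Lemma sigma_scale_inv_cvg0 (s : R) : 2^-1 <= s -> s < 1 ->
  (sigma_scale s x)^-1 @[x --> 0^'+] --> (0 : R).
Proof.
move=> s2 s1; rewrite /sigma_scale; case: eqVneq => sE.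
  apply/gtr0_cvgV0.
    by near=> x; rewrite ln_gt0// invf_gt1//; near: x; exact: nbhs_right_lt.
  apply: (@cvg_trans _ ((fun x : R => - ln x) @ 0^'+)).
    by apply: near_eq_cvg; near=> x; rewrite lnV// posrE.
  by apply/cvgNry; exact: lnNy.
have s3 : 2^-1 < s by rewrite lt_neqAle eq_sym sE.
set K := 2 * s * _ * _ * _.
suff : K * x `^ (2 * s - 1) @[x --> 0^'+] --> (0 : R).
  apply: cvg_trans; apply: near_eq_cvg; near=> x.
  by rewrite invf_div -powRN opprB.
rewrite -[X in _ --> X](mulr0 K); apply: cvgM; first exact: cvg_cst.
by apply: powR_cvg0; lra.
Unshelve. all: by end_near. Qed.

Lemma cvg_energy_correction (s : R) (d : nat -> R) : d @ \oo --> 0 ->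
  cvg (energy_correction s (d n) @[n --> \oo]).
Proof.
move=> d0; rewrite /energy_correction; case: eqVneq => _; apply/cvg_ex.
  exists (2^-1 + 0 / 3); apply: cvgD; first exact: cvg_cst.
  by apply: cvgM => //; exact: cvg_cst.
exists (0 / (6 * s) - (2 * s - 1)^-1); apply: cvgB; last exact: cvg_cst.
by apply: cvgM => //; exact: cvg_cst.
Qed.
End Asymptotics.

Unset Implicit Arguments.

Theorem theorem1p5 (R : realType) (s : R) (delta : nat -> R) (L : nat -> nat)
    (u : nat -> R -> R) :
  2^-1 <= s -> s < 1 ->
  (forall n, 0 < delta n) ->
  delta @ \oo --> 0 ->
  (forall n, (0 < L n)%N) ->
  (forall n, is_minimizer ((L n)%:R * ((delta n)^-1 + 1) * delta n)
                          ((delta n)^-1) (delta n) s (u n)) ->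
  (fun n => FT ((L n)%:R * ((delta n)^-1 + 1) * delta n) s (u n)
            * ((sigma_scale s (delta n))^-1)%:E)%E @ \oo --> 1%E.
Proof.
move=> s2 s1 d0 dcvg L0 umin.
pose iota n := (sigma_scale s (delta n))^-1.
have iota0 : iota @ \oo --> (0 : R).
  by have /cvg_at_rightP := sigma_scale_inv_cvg0 s2 s1; apply; split.
have [c corr_c] : exists c : R, energy_correction s (delta n) @[n --> \oo] --> c.
  by apply/cvg_ex; exact: cvg_energy_correction.
(* The bound [((1 + delta)(sigma + correction) + K)/sigma], written so that every factor has a
   visible limit; [K = - 1/(2 - 2s)] is the lower bound and [K = 1] the upper one. *)
pose bound (K : R) n := (1 + delta n) * (1 + energy_correction s (delta n) * iota n) + K * iota n.
have bound1 K : (EFin \o bound K) @ \oo --> 1%E.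
  apply: cvg_EFin; first by near=> n.
  have -> : (1 : R) = (1 + 0) * (1 + c * 0) + K * 0 by ring.
  apply: cvgD; apply: cvgM => //; try exact: cvg_cst.
    by apply: cvgD => //; exact: cvg_cst.
  by apply: cvgD; [exact: cvg_cst|apply: cvgM].
apply: (squeeze_cvge _ (bound1 (- (2 - 2 * s)^-1)) (bound1 1)).
near=> n.
have d1 : delta n < 1.
  by near: n; apply: (cvgr_lt 0).
have sg0 : 0 < sigma_scale s (delta n) by exact: sigma_scale_gt0.
have [adm opt] := umin n.
have lower := FT_lower s2 s1 (d0 n) d1 (L0 n) adm.
have upper := le_trans (opt _ (sawtooth_admissible (d0 n) (L n)))
  (FT_sawtooth_upper s2 s1 (d0 n) d1 (L0 n)).
have scale K : (bound K n)%:E = (((1 + delta n) * (sigma_scale s (delta n) +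
    energy_correction s (delta n)) + K)%:E * (iota n)%:E)%E.
  by rewrite -EFinM /bound /iota; congr (_%:E); field; rewrite gt_eqF.
have i0 : (0 <= (iota n)%:E)%E by rewrite lee_fin invr_ge0 ltW.
rewrite /comp !scale; apply/andP; split; exact: lee_wpmul2r.
Unshelve. all: by end_near. Qed.
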